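(* The set of maps $f\in C_\lambda(I)$ that are locally eventually onto, satisfy $\lambda(\mathrm{Per}(f))=1$, and satisfy $\lambda(\mathrm{Per}(f,k))>0$ for every $k\ge1$, is dense in $C_\lambda(I)$.
   Context: $I=[0,1]$, $\lambda$ is Lebesgue measure. $C_\lambda(I)$ is the set of continuous maps $f\colon I\to I$ preserving $\lambda$ (i.e. $\lambda(f^{-1}(A))=\lambda(A)$ for every Borel $A\subset I$), with the uniform metric $\rho(f,g)=\sup_{x\in I}|f(x)-g(x)|$. A map $f$ is locally eventually onto (leo) if for every nonempty open interval $J\subset I$ there is $n\ge0$ with $f^n(J)=I$. $\mathrm{Per}(f,k)=\{x: f^k(x)=x,\ f^i(x)\ne x \text{ for } 1\le i<k\}$ and $\mathrm{Per}(f)=\bigcup_{k\ge1}\mathrm{Per}(f,k)$. *)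

(* Defs.v *)
From HB Require Import structures.
From mathcomp Require Import all_boot all_order all_algebra.
From mathcomp Require Import all_classical all_reals all_analysis.
Set Implicit Arguments. Unset Strict Implicit. Unset Printing Implicit Defensive.
Import Order.TTheory GRing.Theory Num.Theory.
Import numFieldNormedType.Exports.
Local Open Scope classical_set_scope.
Local Open Scope ring_scope.

Section Defs.
Variable R : realType.

Definition I01 : set R := `[0, 1]%classic.

Definition leb : set (measurableTypeR R) -> \bar R := lebesgue_measure.

Definition in_C_lambda (f : R -> R) : Prop :=
  [/\ (forall x, I01 x -> I01 (f x)),
      {within I01, continuous f} &
      (forall A : set R, measurable A -> A `<=` I01 ->
         leb (I01 `&` f @^-1` A) = leb A)].

Definition leo (f : R -> R) : Prop :=
  forall a b : R, 0 <= a -> a < b -> b <= 1 ->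
    exists n : nat, (iter n f) @` `]a, b[%classic = I01.

Definition Per_k (f : R -> R) (k : nat) : set R :=
  [set x | I01 x /\ iter k f x = x /\
           (forall i : nat, (1 <= i)%N -> (i < k)%N -> iter i f x <> x)].

Definition Per (f : R -> R) : set R :=
  \bigcup_(k in [set k : nat | (1 <= k)%N]) Per_k f k.

End Defs.

(* Main.v *)
Require Import Defs.
From HB Require Import structures.
From mathcomp Require Import all_boot all_order all_algebra all_fingroup.
From mathcomp Require Import all_classical all_reals all_analysis.
From mathcomp Require Import measurable_realfun zify ring lra.
Import Order.TTheory GRing.Theory Num.Theory.
Import numFieldNormedType.Exports.
Set Implicit Arguments.
Unset Strict Implicit.
Unset Printing Implicit Defensive.

(** The map [f] is a uniform limit of step functions given by permutations of
    [M_n] cells of equal length, adjacent cells having nearby images. Such a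
    permutation close to [g] is the ranking of the values [g (i / M)], because
    [g] preserves Lebesgue measure. To pass to the next level, each cell is cut
    into many pieces, which are first permuted along with the cell. A few pieces
    at the end of each cell are then sent one by one along a path of small steps
    that sweeps a neighbourhood of the image of the cell and ends next to the
    image of the following cell, and the displaced pieces are swapped back. This
    destroys the large jumps between cells, moves only pieces of tiny total
    measure, and makes the image of each cell overlap its neighbours, so that
    the images of an interval under the iterates of [f] grow until they fill
    [0, 1]. Off the modified pieces [f] is a periodic exchange of intervals,
    hence it preserves the measure and almost every point is periodic. A cell
    fixed by every permutation leaves room for a cycle of any prescribed
    length. *)

(** * Permutations of [0, M[ *)

Definition permn (M : nat) (p : nat -> nat) : Prop :=
  (forall i, i < M -> p i < M) /\
  (forall i j, i < M -> j < M -> p i = p j -> i = j).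

Lemma permn_perm M p : permn M p ->
  exists s : {perm 'I_M}, forall i : 'I_M, s i = p i :> nat.
Proof.
move=> [pM pI]; pose f (i : 'I_M) := Ordinal (pM i (ltn_ord i)).
have fI : injective f by move=> i j [] /pI e; apply/val_inj/e.
by exists (perm fI) => i; rewrite permE.
Qed.

Lemma permn_order M p : permn M p ->
  exists2 o, 0 < o & forall i, i < M -> iter o p i = i.
Proof.
move=> /permn_perm[s sE]; exists #[s]%g; first exact: order_gt0.
move=> i iM; have -> : iter #[s]%g p i = (s ^+ #[s])%g (Ordinal iM).
  rewrite permX; elim: #[s]%g => //= n IH; rewrite sE.
  by congr p; exact: IH.
by rewrite expg_order perm1.
Qed.

Lemma permn_surj M p y : permn M p -> y < M -> exists2 x, x < M & p x = y.
Proof.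
move=> /permn_perm[s sE] yM; exists (s^-1 (Ordinal yM))%g => //.
by rewrite -sE permKV.
Qed.

Lemma permn_comp M p q : permn M p -> permn M q -> permn M (p \o q).
Proof.
move=> [pM pI] [qM qI]; split=> [i iM|i j iM jM] /=; first exact/pM/qM.
by move=> /pI e; apply: qI => //; apply: e; apply: qM.
Qed.

Definition transp (x z y : nat) := if y == x then z else if y == z then x else y.

Lemma permn_transp M x z : x < M -> z < M -> permn M (transp x z).
Proof.
move=> xM zM; rewrite /transp; split=> [i iM|i j iM jM]; first by repeat case: ifP => _.
by repeat case: ifP; lia.
Qed.

(** Pigeonhole: block [j] has [m] preimages under [p], more than [U] can hold. *)
Lemma fiber_avoid K m p (U : seq nat) j : permn (K * m) p -> j < K ->
  size U < m -> exists z, [/\ z < K * m, z \notin U & p z %/ m = j].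
Proof.
move=> pP jK Um.
suff [y yj yU] : exists2 y, y \in iota (j * m) m & y \notin map p U.
  move: yj; rewrite mem_iota => /andP[y1 y2].
  have yM : y < K * m by nia.
  have [z zM pz] := permn_surj pP yM; exists z; split=> //.
    by apply: contra yU => zU; rewrite -pz; apply: map_f.
  rewrite pz; apply/eqP.
  by rewrite eqn_leq leq_divRL ?(leq_trans _ Um)// -ltnS ltn_divLR; nia.
have : ~~ all [in map p U] (iota (j * m) m).
  apply/negP => /allP /(uniq_leq_size (iota_uniq _ _)).
  by rewrite size_iota size_map; lia.
by rewrite -has_predC => /hasP[y]; exists y.
Qed.

Definition near1 a b := (a <= b.+1) && (b <= a.+1).

(* Each swap moves the image of [x] to an adjacent block and moves the image of
   one fresh point back across the same block boundary. *)
Lemma move_image K m p (U : seq nat) x t : permn (K * m) p -> x < K * m ->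
  x \in U -> t < K -> size U + K < m ->
  exists (p' : nat -> nat) (V : seq nat),
    [/\ permn (K * m) p', p' x %/ m = t, size V <= K,
        (forall z, z \in V ->
           [/\ z \notin U, z < K * m & near1 (p' z %/ m) (p z %/ m)]) &
        (forall z, z != x -> z \notin V -> p' z = p z)].
Proof.
move=> pP xM xU tK UK.
(* Induction on a bound [n] for the distance from the block of [p x] to [t], written as a sum of two
   truncated differences; each swap shortens it by one. *)
suff : forall n p U, permn (K * m) p -> x \in U -> size U + n < m ->
    p x %/ m - t + (t - p x %/ m) <= n ->
  exists (p' : nat -> nat) (V : seq nat),
    [/\ permn (K * m) p', p' x %/ m = t, size V <= n,
        (forall z, z \in V ->
           [/\ z \notin U, z < K * m & near1 (p' z %/ m) (p z %/ m)]) &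
        (forall z, z != x -> z \notin V -> p' z = p z)].
  have pxK : p x %/ m < K by rewrite ltn_divLR; [case: pP => + _; apply|lia].
  by apply=> //; move: pxK; move: (p x %/ m) => d; lia.
elim=> {p U xU UK pP} [|n IH] p U pP xU Un dn.
  exists p, [::]; split=> //.
  by move: dn; move: (p x %/ m) => d; lia.
have [e|ne] := eqVneq (p x %/ m) t; first by exists p, [::]; split.
have pxK : p x %/ m < K by rewrite ltn_divLR; [case: pP => + _; apply|lia].
pose j := if p x %/ m < t then (p x %/ m).+1 else (p x %/ m).-1.
have jK : j < K by move: pxK ne; rewrite /j; move: (p x %/ m) => d; case: ifP; lia.
have Um : size U < m by lia.
have [z [zM zU pz]] := fiber_avoid pP jK Um.
have zx : z != x by apply: contra zU => /eqP ->.
pose q := p \o transp x z.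
have qx : q x = p z by rewrite /q /transp /= eqxx.
have qz : q z = p x by rewrite /q /transp /= (negPf zx) eqxx.
have qP : permn (K * m) q by apply: permn_comp => //; exact: permn_transp.
(* Adding [z] to [U] keeps the later swaps from displacing it again. *)
have [|||p' [V [p'P p'x sV Vp' p'q]]] := IH q (z :: U) qP.
- by rewrite inE xU orbT.
- by rewrite /= addSnnS.
- by rewrite qx pz; move: ne dn; rewrite /j; move: (p x %/ m) => d; case: ifP; lia.
have zV : z \notin V by apply/negP => /Vp'[]; rewrite inE eqxx.
exists p', (z :: V); split=> //.
- move=> y; rewrite inE => /predU1P[->|yV].
    split=> //; rewrite p'q // qz pz /near1 /j.
    by move: ne; move: (p x %/ m) => d; case: ifP; lia.
  have [] := Vp' _ yV; rewrite inE negb_or => /andP[yz yU] yM.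
  rewrite /q /transp /= (negPf yz).
  by have -> : (y == x) = false by apply: contraNF yU => /eqP ->.
- move=> y yx; rewrite inE negb_or => /andP[yz yV]; rewrite p'q //.
  by rewrite /q /transp /= (negPf yx) (negPf yz).
Qed.

(** The points of [xs] are treated in turn, those already displaced being added to [U]; so a point
    of [V] is displaced only once, by at most one block. *)
Lemma move_images K m (t : nat -> nat) (xs U : seq nat) p : permn (K * m) p ->
  uniq xs -> {subset xs <= U} ->
  (forall x, x \in xs -> x < K * m /\ t x < K) ->
  size U + size xs * K < m ->
  exists (p' : nat -> nat) (V : seq nat),
    [/\ permn (K * m) p', (forall x, x \in xs -> p' x %/ m = t x),
        size V <= size xs * K,
        (forall z, z \in V ->
           [/\ z \notin U, z < K * m & near1 (p' z %/ m) (p z %/ m)]) &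
        (forall z, z \notin xs -> z \notin V -> p' z = p z)].
Proof.
elim: xs U p => [|x xs IH] U p pP uxs xsU xsM sU.
  by exists p, [::]; split.
move: uxs => /= /andP[xxs uxs].
have xU : x \in U by apply: xsU; rewrite mem_head.
have [xM tK] := xsM _ (mem_head _ _).
have sU1 : size U + K < m by move: sU => /=; lia.
have [q [V [qP qx sV VU qp]]] := move_image pP xM xU tK sU1.
have [|||p' [W [p'P p'x sW WU p'q]]] := IH (U ++ V) q qP uxs.
- by move=> y yxs; rewrite mem_cat xsU // inE yxs orbT.
- by move=> y yxs; apply: xsM; rewrite inE yxs orbT.
- by move: sU; rewrite size_cat /=; lia.
have fix1 y : y \in U ++ V -> y \notin xs -> p' y = q y.
  by move=> yUV yxs; apply: p'q => //; apply/negP => /WU[]; rewrite yUV.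
have Vxs y : y \in V -> y \notin x :: xs.
  by move=> /VU[yU _ _]; apply: contra yU; exact: xsU.
exists p', (V ++ W); split=> //.
- move=> y; rewrite inE => /predU1P[->|/p'x//].
  by rewrite fix1 // mem_cat xU.
- by rewrite size_cat /=; lia.
- move=> y; rewrite mem_cat => /orP[yV|yW].
    have [yU yM yn] := VU _ yV; split=> //.
    have := Vxs _ yV; rewrite inE negb_or => /andP[_ yxs].
    by rewrite fix1 // mem_cat yV orbT.
  have [] := WU _ yW; rewrite mem_cat negb_or => /andP[yU yV] yM.
  by rewrite (qp y) //; apply: contraNneq yU => ->.
- move=> y; rewrite inE mem_cat !negb_or => /andP[yx yxs] /andP[yV yW].
  by rewrite p'q // qp.
Qed.

(** * Refining a permutation *)

Definition refine (p : nat -> nat) w z := p (z %/ w) * w + z %% w.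

Lemma permn_refine M p w : 0 < w -> permn M p -> permn (M * w) (refine p w).
Proof.
move=> w0 [pM pI]; rewrite /refine.
have m0 z : z %% w < w by rewrite ltn_mod.
have d0 z : z < M * w -> z %/ w < M by rewrite ltn_divLR.
split=> [i /d0/pM iM|i j /d0 iM /d0 jM e].
  by have := m0 i; nia.
have e1 : i %% w = j %% w.
  by have := congr1 (modn^~ w) e; rewrite /= !modnMDl !modn_mod.
have : p (i %/ w) * w = p (j %/ w) * w by lia.
move=> /eqP; rewrite eqn_pmul2r // => /eqP /pI e2.
by rewrite (divn_eq i w) (divn_eq j w) e2 ?e1.
Qed.

(** The [k]-cycle on [a.+1, ..., a + k]; [a] stays fixed and serves as the fixed cell of the next
    level. *)
Definition rot_block a k z :=
  if (a < z <= a + k) then (if z < a + k then z.+1 else a.+1) else z.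

Lemma permn_rot_block M a k : a + k < M -> permn M (rot_block a k).
Proof.
move=> akM; rewrite /rot_block; split=> [i iM|i j iM jM].
  by repeat case: ifP; lia.
by repeat case: ifP; lia.
Qed.

Lemma iter_rot_block a k j : j < k -> iter j (rot_block a k) a.+1 = a.+1 + j.
Proof.
elim: j => [|j IH] jk; first by rewrite addn0.
by rewrite /= IH; [rewrite /rot_block; repeat case: ifP; lia|lia].
Qed.

(* The itinerary [a -> lo -> hi -> b], each leg taking time [K]. *)
Definition walk K lo hi a b k :=
  if k < K then maxn lo (a - k)
  else if k < 2 * K then minn hi (lo + (k - K))
  else maxn b (hi - (k - 2 * K)).

Section Walk.
Variables (K lo hi a b : nat).
Hypotheses (loa : lo <= a) (ahi : a <= hi) (lob : lo <= b) (bhi : b <= hi)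
  (hiK : hi < K).

Lemma walk_range k : lo <= walk K lo hi a b k <= hi.
Proof. by rewrite /walk; repeat case: ifP; lia. Qed.

Lemma walk_start : walk K lo hi a b 0 = a.
Proof. by rewrite /walk; repeat case: ifP; lia. Qed.

Lemma walk_end : walk K lo hi a b (3 * K).-1 = b.
Proof. by rewrite /walk; repeat case: ifP; lia. Qed.

Lemma walk_near k : near1 (walk K lo hi a b k) (walk K lo hi a b k.+1).
Proof. by rewrite /walk /near1; repeat case: ifP; lia. Qed.

Lemma walk_onto j : lo <= j <= hi ->
  exists2 k, k < 3 * K & walk K lo hi a b k = j.
Proof.
by move=> jb; exists (K + (j - lo)); [lia|rewrite /walk; repeat case: ifP; lia].
Qed.
End Walk.

(* [sM] cells, permutation [sp] with fixed cell [se]; [sr] bounds the jumps of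
   [sp] and is the radius swept at the next level. [sw] (pieces per cell) and
   [sB] (bad pieces, saturated under orbits) refer to the passage from the
   previous level and are dummies at level 0. *)
Record state := State { sM : nat; sp : nat -> nat; sr : nat; se : nat;
  sw : nat; sB : seq nat }.

(** The cell [se S] will host the cycle of the next level; [1 < sr S] leaves room for the two
    neighbour steps in [fat_image_covered]. *)
Definition good S := [/\ 0 < sM S, permn (sM S) (sp S),
  (forall i, i.+1 < sM S -> sp S i <= sp S i.+1 + sr S /\
                           sp S i.+1 <= sp S i + sr S),
  se S < sM S /\ sp S (se S) = se S & 1 < sr S].

(** [step_disp] and [step_eps] give uniform convergence; [step_cover] traces preimages from level to
    level; [step_bad] makes the exchange persist off the bad pieces, whose total measure is at most
    [1 / (sM S * 2 ^ n.+2)] by [step_size]; [step_per] supplies the period [n.+1]. *)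
Record step n S S' : Prop := {
  step_w : 0 < sw S';
  step_M : sM S' = sM S * sw S';
  step_disp : forall z, z < sM S' ->
    sw S' * sp S (z %/ sw S') <= sp S' z + sw S' * (sr S + 2) /\
    sp S' z <= sw S' * (sp S (z %/ sw S') + sr S + 2);
  step_eps : 2 * (sr S' + 3) <= sw S' * (sr S + 3);
  step_cover : forall i v, i < sM S -> v < sM S' ->
    sp S i <= v %/ sw S' + sr S -> v %/ sw S' <= sp S i + sr S ->
    exists z, [/\ z < sM S', z %/ sw S' = i, sp S' z <= v + sr S' &
                v <= sp S' z + sr S'];
  step_bad : forall z, z < sM S' -> z \notin sB S' ->
    sp S' z = refine (sp S) (sw S') z /\ refine (sp S) (sw S') z \notin sB S';
  step_size : size (sB S') * sM S * 2 ^ n.+2 <= sM S';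
  step_per : exists2 u, u < sM S' & iter n.+1 (sp S') u = u /\
    forall i, 0 < i -> i < n.+1 -> iter i (sp S') u <> u }.

(** [B] consists of the iterates of [B0] up to time [o]. As [q] has order dividing [o], [B] is
    closed under the inverse of [q], so its complement is closed under [q]. *)
Lemma orbit_saturation N q (B0 : seq nat) o : permn N q -> 0 < o ->
  (forall i, i < N -> iter o q i = i) -> (forall z, z \in B0 -> z < N) ->
  exists B : seq nat, [/\ size B = size B0 * o, {subset B0 <= B} &
    forall z, z < N -> z \notin B -> q z \notin B].
Proof.
move=> [qN qI] o0 qo B0N.
exists [seq iter j q z | z <- B0, j <- iota 0 o]; split.
- by rewrite size_allpairs size_iota.
- move=> z zB; apply/allpairsP; exists (z, 0); split=> //=.
  by rewrite mem_iota.
- move=> z zN; apply: contra => /allpairsP[[b [|j]] /= [bB]].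
    all: rewrite mem_iota /= add0n => jo e.
    apply/allpairsP; exists (b, o.-1); split=> //=; first by rewrite mem_iota; lia.
    apply: qI => //; first by elim: (o.-1) => [|k IH]; [exact: B0N|exact: qN].
    by rewrite -iterS prednK // qo // B0N.
  apply/allpairsP; exists (b, j); split=> //=; first by rewrite mem_iota; lia.
  by apply: qI => //; elim: (j) => [|k IH]; [exact: B0N|exact: qN].
Qed.

(** Converts bounds on the block number [u] of [x] into bounds on [x] itself, for cells of [8 * m]
    pieces; rounding turns [r + 1] into [r + 2]. *)
Lemma block_bounds m x u y r : m * u <= x -> x < m * u + m ->
  8 * y <= u + 8 * (r + 1) -> u <= 8 * (y + r + 1) + 7 ->
  8 * m * y <= x + 8 * m * (r + 2) /\ x <= 8 * m * (y + r + 2).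
Proof.
move=> xu ux /(leq_mul (leqnn m)) + /(leq_mul (leqnn m)).
by rewrite !mulnDr !(mulnCA m 8) -!mulnA; lia.
Qed.

(** * Existence of the next level *)

Section StepExists.
Variables (n M : nat) (p : nat -> nat) (r e o : nat).
Hypotheses (M0 : 0 < M) (pP : permn M p)
  (pr : forall i, i.+1 < M -> p i <= p i.+1 + r /\ p i.+1 <= p i + r)
  (eM : e < M) (pe : p e = e)
  (o0 : 0 < o) (po : forall i, i < M -> iter o p i = i).

(** Each cell is cut into 8 blocks of [m] pieces, so there are [K] blocks; [L] is the duration of a
    walk and [k] the length of the new cycle. [c] bounds the number of touched pieces: [M * L] on
    walks, [M * L * K] swapped back, [k.+1] reserved for the cycle. The other factors of [m] absorb
    the saturation and the powers in [step_size]. *)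
Let K := 8 * M.
Let L := 3 * K.
Let k := n.+1.
Let c := M * L * K.+1 + k.+1.
Let m := o * M * 2 ^ n.+2 * c.+1.
Let w := 8 * m.
Let q := refine p w.
Let a0 := e * w.
Let tau0 := q \o rot_block a0 k.

(** The last [L] pieces of cell [i], collected in [xs], follow a walk through the blocks within [r]
    cells of [p i], from the last block of [p i] to the first block of the image of the next cell.
    Truncated subtraction and [minn] clip the range to [[0, K[]; the last cell returns to its own
    image. *)
Let nxt i := if i.+1 < M then p i.+1 else p i.
Let lo i := 8 * (p i - r).
Let hi i := minn (8 * (p i + r) + 7) K.-1.
Let W i := walk K (lo i) (hi i) (8 * p i + 7) (8 * nxt i).
Let t z := W (z %/ w) (z %% w - (w - L)).
Let xs := undup [seq i * w + (w - L + j) | i <- iota 0 M, j <- iota 0 L].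
Let R0 := iota a0 k.+1.

Let cm : c < m.
Proof.
have h : 0 < 2 ^ n.+2 by rewrite expn_gt0.
have : 0 < o * M * 2 ^ n.+2 by rewrite muln_gt0 h muln_gt0 o0 M0.
by rewrite /m; move: (o * M * _) => y; nia.
Qed.

Let Lm : L < m /\ k.+1 < m.
Proof. by move: cm; rewrite /c; nia. Qed.

Let w0 : 0 < w. Proof. by rewrite /w; lia. Qed.
Let MwE : M * w = K * m. Proof. by rewrite /w /K; lia. Qed.

Let mem_xs z : (z \in xs) = (z < M * w) && (w - L <= z %% w).
Proof.
rewrite mem_undup; apply/allpairsP/andP => [[[i j] /= []]|[zM zL]].
  rewrite !mem_iota /= !add0n => iM jL ->.
  have jw : w - L + j < w by rewrite /w; lia.
  by rewrite modnMDl modn_small //; split; [nia|lia].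
exists (z %/ w, z %% w - (w - L)); split; rewrite /= ?mem_iota /=.
- by rewrite add0n ltn_divLR.
- by have := ltn_pmod z w0; rewrite /w; lia.
- by rewrite {1}(divn_eq z w); lia.
Qed.

Let size_xs : size xs <= M * L.
Proof. by rewrite (leq_trans (size_undup _)) // size_allpairs !size_iota. Qed.

Let pM i : i < M -> p i < M. Proof. by case: pP => + _; apply. Qed.

Let nxtM i : i < M -> [/\ nxt i < M, p i <= nxt i + r & nxt i <= p i + r].
Proof.
move=> iM; rewrite /nxt; case: ifP => i1; last by split; [exact: pM|lia|lia].
by have [] := pr i1; split=> //; exact: pM.
Qed.

Let W_hyps i : i < M -> [/\ lo i <= 8 * p i + 7, 8 * p i + 7 <= hi i,
  lo i <= 8 * nxt i, 8 * nxt i <= hi i & hi i < K].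
Proof.
move=> iM; have h0 := pM iM; have [h1 h2 h3] := nxtM iM.
by rewrite /lo /hi /K; move: (nxt i) h1 h2 h3 => x; split; lia.
Qed.

Let zM z : z < M * w -> z %/ w < M. Proof. by rewrite ltn_divLR. Qed.

(** As [k.+1 < m], the cycle stays inside the first block of cell [e], so it is invisible at the
    scale of blocks. *)
Let rotw z : rot_block a0 k z %/ w = z %/ w /\
   (rot_block a0 k z %% w) %/ m = (z %% w) %/ m.
Proof.
rewrite /rot_block; case: ifP => // /andP[az zk].
have D j : j <= k -> (a0 + j) %/ w = e /\ (a0 + j) %% w %/ m = 0.
  move=> jk; have jm : j < m by lia.
  have jw : j < w by rewrite /w; lia.
  by rewrite /a0 divnMDl // modnMDl (divn_small jw) (modn_small jw) (divn_small jm) addn0.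
have zE : z = a0 + (z - a0) by lia.
have [z1 z2] : z %/ w = e /\ (z %% w) %/ m = 0 by rewrite zE; apply: D; lia.
rewrite z1 z2; case: ifP => zk'; last by rewrite -addn1; apply: D; lia.
have -> : z.+1 = a0 + (z.+1 - a0) by lia.
by apply: D; lia.
Qed.

Let m0 : 0 < m. Proof. by case: Lm; lia. Qed.

Let d_tau0 z : tau0 z %/ m = 8 * p (z %/ w) + (z %% w) %/ m.
Proof.
have [e1 e2] := rotw z; rewrite /tau0 /= /q /refine e1 /w mulnA divnMDl //.
by rewrite -/w e2; lia.
Qed.

Let akM : a0 + k < M * w.
Proof. by rewrite /a0; have := Lm; rewrite /w; nia. Qed.

Let tau0P : permn (K * m) tau0.
Proof.
rewrite -MwE; apply: permn_comp; first exact: permn_refine.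
exact: permn_rot_block.
Qed.

Let R0xs z : z \in R0 -> z \notin xs.
Proof.
rewrite mem_iota => /andP[z1 z2]; rewrite mem_xs negb_and; apply/orP; right.
have zE : z = e * w + (z - a0) by rewrite -/a0; lia.
by rewrite zE modnMDl modn_small; have := Lm; rewrite /w; lia.
Qed.

(** The protected set is [xs ++ R0], so the swaps leave the new cycle and the fixed piece [a0]
    intact. *)
Let tau_exists : exists (p' : nat -> nat) (V : seq nat),
    [/\ permn (K * m) p', (forall x, x \in xs -> p' x %/ m = t x),
        size V <= size xs * K,
        (forall z, z \in V ->
           [/\ z \notin xs ++ R0, z < K * m & near1 (p' z %/ m) (tau0 z %/ m)]) &
        (forall z, z \notin xs -> z \notin V -> p' z = tau0 z)].
Proof.
apply: move_images => //.
- exact: undup_uniq.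
- by move=> x; rewrite mem_cat => ->.
- move=> x; rewrite mem_xs MwE => /andP[xM _]; split=> //.
  have := xM; rewrite -MwE => /zM /W_hyps[h1 h2 h3 h4 h5].
  by have := walk_range h1 h2 h3 h4 h5 (x %% w - (w - L)); rewrite /t /W; lia.
- rewrite size_cat size_iota (leq_ltn_trans _ cm) // /c mulnS.
  have := leq_mul size_xs (leqnn K); have := size_xs.
  by move: (size xs) (M * L) => x y; clear; lia.
Qed.

Lemma step_exists_aux : exists S', good S' /\ step n (State M p r e 0 [::]) S'.
Proof.
have [p' [V [p'P p'xs sV VU p't0]]] := tau_exists.
have qP : permn (M * w) q by apply: permn_refine.
(* [q] moves whole cells and keeps the position inside the cell, so it inherits the order of [p]. *)
have qo z : z < M * w -> iter o q z = z.
  move=> zMw; have zw := zM zMw.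
  have I j : iter j q z = iter j p (z %/ w) * w + z %% w.
    elim: j => [|j IH]; first exact: divn_eq.
    rewrite /= IH /q /refine divnMDl // modnMDl modn_mod.
    by rewrite (divn_small (ltn_pmod _ w0)) addn0.
  by rewrite I po // -divn_eq.
have B0N z : z \in xs ++ V ++ R0 -> z < M * w.
  rewrite !mem_cat => /or3P[|/VU[_ + _]|]; first by rewrite mem_xs => /andP[].
    by rewrite MwE.
  by rewrite mem_iota; have := akM; lia.
have [B [sB B0B Bq]] := orbit_saturation qP o0 qo B0N.
have dz z : z < M * w -> z \notin xs ->
    near1 (p' z %/ m) (8 * p (z %/ w) + (z %% w) %/ m).
  move=> zMw zxs; rewrite -d_tau0; have [/VU[]//|zV] := boolP (z \in V).
  by rewrite p't0 // /near1 leqnSn.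
have dxs z : z < M * w -> w - L <= z %% w -> p' z %/ m = t z.
  by move=> zMw zL; apply: p'xs; rewrite mem_xs zMw.
have zwm z : (z %% w) %/ m < 8 by rewrite ltn_divLR // -/w ltn_mod.
have drange z : z < M * w ->
    8 * p (z %/ w) <= p' z %/ m + 8 * (r + 1) /\
    p' z %/ m <= 8 * (p (z %/ w) + r + 1) + 7.
  move=> zMw; have zw := zM zMw; have [zxs|zxs] := boolP (z \in xs).
    rewrite p'xs //; have [h1 h2 h3 h4 h5] := W_hyps zw.
    have : lo (z %/ w) <= t z <= hi (z %/ w) by apply: walk_range.
    by rewrite /lo /hi; move: (t z) (z %/ w) zw => x y yM; lia.
  have := dz _ zMw zxs; rewrite /near1; move: (zwm z) (p' z %/ m) => zw8 y.
  by move: (z %% w %/ m) zw8 => x; lia.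
have mdiv x : m * (x %/ m) <= x /\ x < m * (x %/ m) + m.
  have := divn_eq x m; have := ltn_pmod x m0.
  by move: (x %% m) (x %/ m) => u v; nia.
have [Lw w8] : L < w /\ w = 8 * m by have := Lm; rewrite /w; split; lia.
have modS z : (z.+1 %/ w = z %/ w /\ z.+1 %% w = (z %% w).+1) \/
    [/\ z.+1 %/ w = (z %/ w).+1, z.+1 %% w = 0 & (z %% w).+1 = w].
  have zE : z.+1 = z %/ w * w + (z %% w).+1 by rewrite {1}(divn_eq z w) addnS.
  have := ltn_pmod z w0; rewrite leq_eqVlt => /predU1P[xw|xw]; [right|left].
    by rewrite zE xw addnC -mulSn mulnK // modnMl.
  by rewrite zE divnMDl // modnMDl (divn_small xw) (modn_small xw) addn0.
(* Four cases: across two cells, entering a walk, along a walk, or before it. The worst is the last: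
   one block for each of the two possible displacements, plus one for a block boundary. *)
have jump z : z.+1 < M * w ->
    p' z %/ m <= p' z.+1 %/ m + 3 /\ p' z.+1 %/ m <= p' z %/ m + 3.
  move=> z1M; have zMw := ltnW z1M; have iM := zM zMw.
  have [h1 h2 h3 h4 h5] := W_hyps iM.
  have [[e1 e2]|[e1 e2 xw]] := modS z; last first.
    have -> : p' z %/ m = 8 * nxt (z %/ w).
      rewrite dxs //; last by lia.
      have xE : z %% w - (w - L) = L.-1 by lia.
      by rewrite /t xE; apply: walk_end.
    have i1M : (z %/ w).+1 < M by rewrite -e1 zM.
    have z1xs : z.+1 \notin xs by rewrite mem_xs e2 negb_and -!ltnNge; lia.
    have := dz _ z1M z1xs; rewrite e2 e1 /nxt i1M div0n /near1.
    by move: (p' z.+1 %/ m) => y; lia.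
  have [xL|xL] := leqP (w - L) (z %% w).
    rewrite !dxs ?e2 //; last by lia.
    have : near1 (t z) (t z.+1).
      by rewrite /t e1 e2 subSn //; apply: walk_near.
    by rewrite /near1; move: (t z) (t z.+1) => x y; lia.
  have := dz _ zMw; rewrite mem_xs (leqNgt (w - L)) xL andbF => /(_ isT).
  have [xL1|xL1] := leqP (w - L) (z %% w).+1.
    rewrite (dxs z.+1) ?e2 // /t e1 e2.
    have -> : (z %% w).+1 - (w - L) = 0 by lia.
    have -> : z %% w %/ m = 7.
      have xE : z %% w = 7 * m + (z %% w - 7 * m) by have := Lm; lia.
      by rewrite xE divnMDl // divn_small ?addn0 //; have := Lm; lia.
    have -> : W (z %/ w) 0 = 8 * p (z %/ w) + 7 by apply: walk_start.
    by rewrite /near1; move: (p' z %/ m) => y; lia.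
  have := dz _ z1M; rewrite mem_xs e1 e2 (leqNgt (w - L)) xL1 andbF => /(_ isT).
  have : (z %% w) %/ m <= (z %% w).+1 %/ m <= ((z %% w) %/ m).+1.
    rewrite leq_div2r // -addn1 -ltnS ltn_divLR //.
    have [_] := mdiv (z %% w); move: (z %% w %/ m) => y; nia.
  rewrite /near1; move: (p' z %/ m) (p' z.+1 %/ m) => y y'.
  by move: (z %% w %/ m) ((z %% w).+1 %/ m) => u v; lia.
(* A jump of at most 3 blocks is a jump of at most [4 * m] pieces after rounding; since [w = 8 * m],
   this also halves the mesh. *)
exists (State (M * w) p' (4 * m) a0 w B); split.
  split=> //=.
  - by rewrite muln_gt0 M0.
  - by rewrite MwE.
  - move=> z /jump[]; have [a1 a2] := mdiv (p' z); have [b1 b2] := mdiv (p' z.+1).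
    move=> /(leq_mul (leqnn m)) + /(leq_mul (leqnn m)); rewrite !mulnDr.
    by move: (m * _) (m * _) a1 a2 b1 b2 => u v; lia.
  - split; first by have := akM; lia.
    have aE : a0 %/ w = e by rewrite /a0 mulnK.
    rewrite p't0 /=.
      by rewrite /tau0 /= /rot_block ltnn /= /q /refine aE pe /a0 modnMl addn0.
      by apply: R0xs; rewrite mem_iota leqnn /=; lia.
    by apply/negP => /VU[]; rewrite mem_cat mem_iota leqnn /= negb_or => /andP[_]; lia.
  - lia.
split=> //=.
- move=> z /drange[d1 d2]; have [a1 a2] := mdiv (p' z).
  by rewrite w8; apply: (block_bounds a1 a2).
- by rewrite w8 !mulnDr; lia.
- move=> i v iM vM v1 v2; have [h1 h2 h3 h4 h5] := W_hyps iM.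
  have vw : v %/ m %/ 8 = v %/ w by rewrite w8 mulnC divnMA.
  have vK : v %/ m < K by rewrite ltn_divLR // -MwE.
  have : lo i <= v %/ m <= hi i.
    by rewrite /lo /hi; move: (v %/ m) vK vw => j jK jw; lia.
  (* The walk of cell [i] visits the block of [v] at some time [j]; the piece visited then has its
     image in the same block as [v], hence within [m] of it. *)
  move=> /(walk_onto h1 h2 h3 h4 h5)[j jL Wj].
  have jw : w - L + j < w by lia.
  have zw : (i * w + (w - L + j)) %/ w = i by rewrite divnMDl // divn_small ?addn0.
  have zmw : (i * w + (w - L + j)) %% w = w - L + j by rewrite modnMDl modn_small.
  have zMw : i * w + (w - L + j) < M * w.
    by rewrite (leq_trans _ (leq_mul iM (leqnn w))) // mulSn addnC ltn_add2r.
  exists (i * w + (w - L + j)).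
  have : p' (i * w + (w - L + j)) %/ m = v %/ m.
    by rewrite dxs ?zmw ?leq_addr // /t zw zmw addKn.
  have [a1 a2] := mdiv v; have [] := mdiv (p' (i * w + (w - L + j))).
  by move=> + + E; rewrite E; move: (m * _) a1 a2 => u; split=> //; lia.
- move=> z zMw zB; split; last exact: Bq.
  have [zxs zV zR] : [/\ z \notin xs, z \notin V & z \notin R0].
    by split; apply: contra zB => h; apply: B0B; rewrite !mem_cat h ?orbT.
  rewrite p't0 //; have zr : ~~ (a0 < z <= a0 + k).
    by apply: contra zR => zr; rewrite /R0 mem_iota; lia.
  by rewrite /tau0 /= /rot_block (negPf zr).
- have sB0 : size (xs ++ V ++ R0) <= c.
    rewrite !size_cat size_iota /c mulnS.
    have := leq_mul size_xs (leqnn K); have := size_xs; have := sV.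
    by move: (size xs) (size V) (M * L) => x y u; lia.
  rewrite sB; apply: (@leq_trans (c * o * M * 2 ^ n.+2)).
    by rewrite !leq_mul.
  rewrite w8 /m; move: (2 ^ n.+2) => y; move: c => c'.
  rewrite (_ : c' * o * M * y = 1 * (o * M * y * c')); last by lia.
  rewrite [in leqRHS]mulnA; apply: leq_mul; first by lia.
  by rewrite leq_mul2l leqnSn orbT.
(* On [R0] no walk or swap interferes and [q] is the identity because [p e = e], so [p'] is the bare
   cycle there; its first element [a0.+1] has period [k = n.+1]. *)
- have rot_p' z : z \in R0 -> p' z = rot_block a0 k z.
    move=> zR; rewrite p't0 ?R0xs //; last first.
      by apply/negP => /VU[]; rewrite mem_cat zR orbT.
    have zRr : rot_block a0 k z \in R0.
      by move: zR; rewrite /R0 !mem_iota /rot_block; repeat case: ifP; lia.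
    rewrite /tau0 /= /q /refine; move: (rot_block _ _ _) zRr => y.
    rewrite mem_iota => yR.
    have [yE yw] : y = e * w + (y - a0) /\ y - a0 < w.
      by rewrite -/a0; have := Lm; lia.
    have -> : y %/ w = e by rewrite yE divnMDl // divn_small ?addn0.
    by rewrite pe {2}yE -/a0 [in X in _ + X = _]yE modnMDl modn_small.
  have it j : iter j p' a0.+1 = iter j (rot_block a0 k) a0.+1 /\
              iter j (rot_block a0 k) a0.+1 \in R0.
    elim: j => [|j [IH1 IH2]]; first by split; rewrite /R0 ?mem_iota /k /=; lia.
    rewrite /= IH1 rot_p' //; split=> //.
    move: IH2; move: (iter j _ _) => y.
    by rewrite /R0 !mem_iota /rot_block; repeat case: ifP; lia.
  exists a0.+1; first by have := akM; rewrite /k; lia.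
  split=> [|i i0 ik]; [apply: etrans (it n.+1).1 _|rewrite (it i).1].
    by rewrite /= iter_rot_block // /rot_block /k; repeat case: ifP; lia.
  by rewrite iter_rot_block //; lia.
Qed.
End StepExists.

Lemma step_exists n S : good S -> exists S', good S' /\ step n S S'.
Proof.
case: S => M p r e w B [/= M0 pP pr [eM pe] r0].
have [l l0 pl] := permn_order pP.
have [S' [gS' sS']] := step_exists_aux n M0 pP pr eM pe l0 pl.
by exists S'; split=> //; case: sS' => *; split.
Qed.

Local Open Scope classical_set_scope.
Local Open Scope ring_scope.

(** * The limit map *)

Lemma chain_exists S0 : good S0 -> exists S : nat -> state,
  [/\ S 0%N = S0, forall n, good (S n) & forall n, step n (S n) (S n.+1)].
Proof.
move=> gS0.
pose nx n (S : {S | good S}) : {S | good S} :=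
  let c := cid (step_exists n (svalP S)) in exist _ (sval c) (svalP c).1.
pose fix C n : {S | good S} :=
  if n is n'.+1 then nx n' (C n') else exist _ S0 gS0.
exists (fun n => sval (C n)); split=> // n; first exact: svalP.
exact: (svalP (cid (step_exists n (svalP (C n))))).2.
Qed.

(** * The cell containing a point *)

Section Index.
Variable R : realType.
Implicit Types (x y : R) (N w i : nat).

(* Points outside [0, 1[ are sent to the nearest cell. *)
Definition idx N x : nat := minn (Num.truncn (x * N%:R)) N.-1.

Lemma idx_lt N x : (0 < N)%N -> (idx N x < N)%N.
Proof. by rewrite /idx; lia. Qed.

Lemma natr_pos N : (0 < N)%N -> 0 < N%:R :> R. Proof. by rewrite ltr0n. Qed.

Lemma idxE N x i : (i < N)%N -> i%:R / N%:R <= x < i.+1%:R / N%:R -> idx N x = i.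
Proof.
move=> iN; have N0 : 0 < N%:R :> R by rewrite ltr0n; lia.
rewrite ler_pdivrMr // ltr_pdivlMr // => /truncn_def; rewrite /idx => ->.
by lia.
Qed.

(** The right end is included for the sake of [x = 1], which is clamped to the last cell. *)
Lemma idx_itv N x : (0 < N)%N -> 0 <= x <= 1 ->
  (idx N x)%:R / N%:R <= x <= (idx N x).+1%:R / N%:R.
Proof.
move=> N0 /andP[x0 x1]; have N0' := natr_pos N0.
rewrite ler_pdivrMr // ler_pdivlMr // /idx.
have /truncn_itv/andP[t1 t2] : 0 <= x * N%:R by rewrite mulr_ge0 // ltW.
rewrite /minn; case: ltnP => h; first by rewrite t1 ltW.
rewrite prednK //; apply/andP; split.
  by rewrite (le_trans _ t1) // ler_nat.
by rewrite -[leRHS]mul1r ler_wpM2r // ltW.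
Qed.

Lemma idx_itvo N x : (0 < N)%N -> 0 <= x < 1 ->
  (idx N x)%:R / N%:R <= x < (idx N x).+1%:R / N%:R.
Proof.
move=> N0 /andP[x0 x1]; have N0' := natr_pos N0.
have x01 : 0 <= x <= 1 by rewrite x0 ltW.
have /andP[-> _] := idx_itv N0 x01; rewrite /= ltr_pdivlMr // /idx.
have /truncn_itv/andP[t1 t2] : 0 <= x * N%:R by rewrite mulr_ge0 // ltW.
rewrite /minn; case: ltnP => // _; rewrite prednK //.
by rewrite -[ltRHS]mul1r ltr_pM2r.
Qed.

(** Inside [[0, 1[] this is nesting of cells; outside, clamping gives the first or the last cell at
    both levels. *)
Lemma idx_div N w x : (0 < N)%N -> (0 < w)%N -> (idx (N * w) x %/ w)%N = idx N x.
Proof.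
move=> N0 w0; have Nw0 : (0 < N * w)%N by rewrite muln_gt0 N0.
have [x0|x0] := ltP x 0.
  have t0 K : Num.truncn (x * K%:R) = 0%N.
    apply/truncn0Pn; rewrite -ltNge (le_lt_trans _ ltr01) //.
    by rewrite mulr_le0_ge0 // ltW.
  by rewrite /idx !t0 !min0n div0n.
have [x1|x1] := leP 1 x.
  have e K : (0 < K)%N -> idx K x = K.-1.
    move=> K0; rewrite /idx /minn; case: ltnP => // h.
    have : (K <= Num.truncn (x * K%:R))%N.
      rewrite truncn_ge_nat; last by rewrite mulr_ge0 // (le_trans _ x1).
      by rewrite -[leLHS]mul1r ler_wpM2r.
    by lia.
  rewrite !e //; apply/eqP; rewrite eqn_leq -ltnS prednK // ltn_divLR //.
  rewrite prednK // leqnn leq_divRL // /=; nia.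
have x01 : 0 <= x < 1 by rewrite x0.
apply/esym/idxE; first by rewrite ltn_divLR // idx_lt.
have /andP[h1 h2] := idx_itvo Nw0 x01; set j := idx _ _ in h1 h2 *.
have := divn_eq j w; have := ltn_pmod j w0; set a := (j %/ w)%N; set b := (j %% w)%N.
move=> bw jE; have Nr := natr_pos N0; have wr := natr_pos w0.
move: h1 h2; rewrite natrM ler_pdivrMr ?mulr_gt0 // ltr_pdivlMr ?mulr_gt0 // => h1 h2.
rewrite ler_pdivrMr // ltr_pdivlMr //; apply/andP; split.
  rewrite -(ler_pM2r wr) -mulrA (le_trans _ h1) // -natrM ler_nat jE; lia.
rewrite -(ltr_pM2r wr) -mulrA (lt_le_trans h2) // -natrM ler_nat jE; nia.
Qed.

Lemma idx_near N x y : (0 < N)%N -> `|x - y| < N%:R^-1 -> near1 (idx N x) (idx N y).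
Proof.
move=> N0; have Nr := natr_pos N0.
suff H u v : u - v < N%:R^-1 -> (idx N u <= (idx N v).+1)%N.
  by rewrite ltr_norml => /andP[h1 h2]; rewrite /near1 !H //; lra.
move=> uv; rewrite /idx.
have clamp a b : (a <= b.+1)%N -> (minn a N.-1 <= (minn b N.-1).+1)%N by lia.
apply: clamp.
have [v0|v0] := leP 0 (v * N%:R); last first.
  have -> // : Num.truncn (u * N%:R) = 0%N.
  apply/truncn0Pn; rewrite -ltNge.
  have : (u - v) * N%:R < 1 by rewrite -ltr_pdivlMr // div1r.
  by rewrite mulrBl; lra.
rewrite -ltnS; have [u0|u0] := leP 0 (u * N%:R); last first.
  suff -> : Num.truncn (u * N%:R) = 0%N by [].
  by apply/truncn0Pn; rewrite -ltNge (lt_trans u0).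
have : (u - v) * N%:R < 1 by rewrite -ltr_pdivlMr // div1r.
have /andP[_] := truncn_itv v0.
rewrite mulrBl truncn_lt_nat // -[in X in _ -> _ -> X]natr1 => h1 h2.
lra.
Qed.
End Index.

Definition step_fun (R : realType) (T : state) (x : R) : R :=
  (sp T (idx (sM T) x))%:R / (sM T)%:R.

(** The jump bound in units of length, with a slack of three cells: it dominates the change to the
    next level and halves at each level. *)
Definition mesh (R : realType) (T : state) : R := (sr T + 3)%:R / (sM T)%:R.

Lemma subcell (R : realType) N w z (x : R) : (0 < N)%N -> (0 < w)%N ->
  z%:R / (N * w)%:R <= x <= z.+1%:R / (N * w)%:R ->
  (z %/ w)%:R / N%:R <= x <= (z %/ w).+1%:R / N%:R.
Proof.
move=> N0 w0; have N0' : 0 < N%:R :> R by rewrite ltr0n.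
have w0' : 0 < w%:R :> R by rewrite ltr0n.
rewrite natrM !ler_pdivrMr ?mulr_gt0 // !ler_pdivlMr ?mulr_gt0 // mulrA.
move=> /andP[x1 x2]; apply/andP; split; rewrite -(ler_pM2r w0') -natrM.
  by apply: le_trans x1; rewrite ler_nat leq_trunc_div.
by apply: le_trans x2 _; rewrite ler_nat ltn_ceil.
Qed.

(** * Convergence, continuity and preimages inside cells *)

Section Limit.
Variables (R : realType) (S : nat -> state).
Hypotheses (gS : forall n, good (S n)) (sS : forall n, step n (S n) (S n.+1)).
Local Notation M n := (sM (S n)).
Local Notation p n := (sp (S n)).
Local Notation r n := (sr (S n)).
Local Notation w n := (sw (S n.+1)).
Local Notation eps n := (mesh R (S n)).
Implicit Types x y v : R.

Lemma M_gt0 n : (0 < M n)%N. Proof. by case: (gS n). Qed.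
Let w_gt0 n : (0 < w n)%N. Proof. exact: step_w (sS n). Qed.
Let M_R n : 0 < (M n)%:R :> R. Proof. by rewrite ltr0n M_gt0. Qed.
Let w_R n : 0 < (w n)%:R :> R. Proof. by rewrite ltr0n. Qed.
Let MS n : M n.+1 = (M n * w n)%N. Proof. exact: step_M (sS n). Qed.
Let pM n i : (i < M n)%N -> (p n i < M n)%N.
Proof. by case: (gS n) => _ [+ _] _ _ _; apply. Qed.

Let idxS n x : (idx (M n.+1) x %/ w n)%N = idx (M n) x.
Proof. by rewrite MS idx_div // M_gt0. Qed.

Lemma eps_gt0 n : 0 < eps n.
Proof. by rewrite divr_gt0 // ltr0n addn3. Qed.

Lemma inv_M_le n : (M n)%:R^-1 <= eps n.
Proof. by rewrite -[leLHS]div1r ler_pM2r ?invr_gt0 // ler1n addn3. Qed.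

Lemma eps_half n : 2 * eps n.+1 <= eps n.
Proof.
rewrite /mesh MS natrM; have -> (a : R) : 2 * (a / ((M n)%:R * (w n)%:R)) =
    2 * a / (w n)%:R / (M n)%:R by field; rewrite !gt_eqF.
rewrite ler_pM2r ?invr_gt0 // ler_pdivrMr // -!natrM ler_nat [leqRHS]mulnC.
exact: step_eps (sS n).
Qed.

Lemma step_funS n x : `|step_fun (S n.+1) x - step_fun (S n) x| <= eps n.
Proof.
have zM : (idx (M n.+1) x < M n.+1)%N by rewrite idx_lt // M_gt0.
have [] := step_disp (sS n) zM; rewrite idxS.
set z := idx (M n.+1) x; set i := idx (M n) x.
rewrite -!(ler_nat R) !(natrD, natrM) => h1 h2.
have -> : step_fun (S n.+1) x - step_fun (S n) x =
    ((p n.+1 z)%:R - (w n)%:R * (p n i)%:R) / (w n)%:R / (M n)%:R.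
  rewrite /step_fun -/z -/i MS natrM; field.
  by rewrite !gt_eqF.
rewrite normrM [`|_^-1|]gtr0_norm ?invr_gt0 // ler_pM2r ?invr_gt0 //.
rewrite normrM [`|_^-1|]gtr0_norm ?invr_gt0 // ler_pdivrMr //.
by rewrite ler_norml natrD; apply/andP; split; have := w_R n; nra.
Qed.

(** The bound telescopes, since [eps_half] gives [eps n <= 2 * eps n - 2 * eps n.+1]. *)
Lemma step_fun_cauchy n k x :
  `|step_fun (S (n + k)) x - step_fun (S n) x| <= 2 * eps n - 2 * eps (n + k).
Proof.
elim: k => [|k IH]; first by rewrite addn0 !subrr normr0.
rewrite addnS; have := step_funS (n + k) x; have := eps_half (n + k).
move: IH; rewrite !ler_norml => /andP[h1 h2] h3 /andP[h4 h5].
by apply/andP; split; lra.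
Qed.

(** The intervals of radius [2 * eps n] around the values [step_fun (S n) x] have every lower end
    below every upper end, so the supremum of the lower ends lies in all of them. *)
Lemma limit_exists : exists f : R -> R, forall n x,
  `|f x - step_fun (S n) x| <= 2 * eps n.
Proof.
pose u x n := step_fun (S n) x - 2 * eps n.
have uv x n m : u x n <= step_fun (S m) x + 2 * eps m.
  have e0 := eps_gt0; rewrite /u; have [nm|mn] := leqP n m.
    have := step_fun_cauchy n (m - n) x; rewrite subnKC // ler_norml => /andP[h1 h2].
    by have := e0 n; have := e0 m; lra.
  have := step_fun_cauchy m (n - m) x; rewrite subnKC 1?ltnW // ler_norml => /andP[h1 h2].
  by have := e0 n; have := e0 m; lra.
exists (fun x => sup (range (u x))) => n x; rewrite ler_norml; apply/andP; split.
  rewrite lerBrDl; apply: ub_le_sup; last by exists n.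
  by exists (step_fun (S 0) x + 2 * eps 0) => _ [m _ <-].
rewrite lerBlDr addrC; apply: ge_sup; first by exists (u x 0%N); exists 0%N.
by move=> _ [m _ <-].
Qed.

Lemma eps_small (d : R) : 0 < d -> exists n, forall m, (n <= m)%N -> eps m < d.
Proof.
move=> d0.
(* Halving is used only through this harmonic decay, to which the Archimedean property applies
   directly. *)
have e k : eps k * k.+1%:R <= eps 0.
  elim: k => [|k IH]; first by rewrite mulr1.
  rewrite (le_trans _ IH) //; have := eps_half k; have := eps_gt0 k.+1.
  have : 0 <= k%:R :> R by []. rewrite -!natr1; nra.
exists (Num.truncn (eps 0 / d)) => m nm.
rewrite -(@ltr_pM2r _ m.+1%:R) ?ltr0n // (le_lt_trans (e m)) //.
rewrite mulrC -ltr_pdivrMr //.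
have /truncn_itv/andP[_ h] : 0 <= eps 0 / d by rewrite divr_ge0 ?ltW ?eps_gt0.
by rewrite (lt_le_trans h) // ler_nat ltnS.
Qed.

Lemma eps_squeeze (c a b : R) : 0 < c ->
  (exists n0, forall n, (n0 <= n)%N -> `|a - b| <= c * eps n) -> a = b.
Proof.
move=> c0 [n0 H]; apply/eqP; rewrite -subr_eq0 -normr_le0; apply/ler_addgt0Pr => d d0.
have [n Hn] : exists n, forall m, (n <= m)%N -> eps m < d / c.
  by apply: eps_small; rewrite divr_gt0.
rewrite add0r (le_trans (H (maxn n n0) (leq_maxr _ _))) //.
by rewrite mulrC -ler_pdivlMr // ltW // Hn // leq_maxl.
Qed.

Variable f : R -> R.
Hypothesis fP : forall n x, `|f x - step_fun (S n) x| <= 2 * eps n.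

Lemma step_fun_near n x y : `|x - y| < (M n)%:R^-1 ->
  `|step_fun (S n) x - step_fun (S n) y| <= eps n.
Proof.
move=> /(idx_near (M_gt0 n)) xy; rewrite /step_fun -mulrBl normrM.
rewrite [`|_^-1|]gtr0_norm ?invr_gt0 // ler_pM2r ?invr_gt0 //.
have [_ _ jump _ _] := gS n.
have H i j : (i < M n)%N -> (j < M n)%N -> near1 i j ->
    (p n i <= p n j + r n)%N /\ (p n j <= p n i + r n)%N.
  move=> iM jM; rewrite /near1 => ij; have [->|ne] := eqVneq i j; first by split; lia.
  have [e|e] : j = i.+1 \/ i = j.+1 by lia.
    by rewrite e; have := jump i; rewrite -e => /(_ jM).
  by rewrite e; have := jump j; rewrite -e => /(_ iM)[].
have [] := H _ _ (idx_lt x (M_gt0 n)) (idx_lt y (M_gt0 n)) xy.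
rewrite -!(ler_nat R) !natrD => h1 h2.
by rewrite ler_norml; apply/andP; split; lra.
Qed.

Lemma limit_modulus n x y : `|x - y| < (M n)%:R^-1 -> `|f x - f y| <= 5 * eps n.
Proof.
move=> /step_fun_near; have := fP n x; have := fP n y.
rewrite !ler_norml => /andP[h1 h2] /andP[h3 h4] /andP[h5 h6].
by apply/andP; split; lra.
Qed.

Lemma limit_continuous : continuous f.
Proof.
move=> x; apply/cvgrPdist_le => d d0.
have [n /(_ n (leqnn n)) Hn] : exists n, forall m, (n <= m)%N -> eps m < d / 5.
  by apply: eps_small; rewrite divr_gt0.
near=> y; apply: (@le_trans _ _ (5 * eps n)); last first.
  by rewrite mulrC -ler_pdivlMr // ltW.
apply: limit_modulus; near: y.
by apply/nbhs_ballP; exists (M n)%:R^-1; rewrite /= ?invr_gt0.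
Unshelve. all: by end_near. Qed.

Lemma step_fun_itv n x : 0 <= step_fun (S n) x <= 1.
Proof.
rewrite /step_fun divr_ge0 //= ler_pdivrMr // mul1r ler_nat ltnW //.
by rewrite pM // idx_lt // M_gt0.
Qed.

Lemma limit_itv x : 0 <= f x <= 1.
Proof.
have H d : 0 < d -> - d <= f x <= 1 + d.
  move=> d0; have [n /(_ n (leqnn n)) Hn] : exists n, forall m, (n <= m)%N -> eps m < d / 2.
    by apply: eps_small; rewrite divr_gt0.
  have := fP n x; have /andP[] := step_fun_itv n x; rewrite ler_norml => h1 h2 /andP[h3 h4].
  by apply/andP; split; lra.
apply/andP; split.
  by apply/ler_addgt0Pr => d /H/andP[h _]; lra.
by apply/ler_addgt0Pr => d /H/andP[].
Qed.

Let val_itv n i x : (i < M n)%N -> i%:R / (M n)%:R <= x < i.+1%:R / (M n)%:R ->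
  step_fun (S n) x = (p n i)%:R / (M n)%:R.
Proof. by move=> iM /(idxE iM) e; rewrite /step_fun e. Qed.

(** [step_cover] picks inside cell [i] a piece whose image lies within the next radius of the cell
    of [v]; the hypotheses are thus reproduced one level down. *)
Lemma approx_preimage v k n i : 0 <= v <= 1 -> (i < M n)%N ->
  (p n i <= idx (M n) v + r n)%N -> (idx (M n) v <= p n i + r n)%N ->
  exists2 x, i%:R / (M n)%:R <= x <= i.+1%:R / (M n)%:R &
    `|f x - v| <= 3 * eps (n + k).
Proof.
move=> v01; elim: k n i => [|k IH] n i iM h1 h2.
  have x01 : i%:R / (M n)%:R <= (i%:R / (M n)%:R : R) < i.+1%:R / (M n)%:R.
    by rewrite lexx ltr_pM2r ?invr_gt0 // ltr_nat /=.
  exists (i%:R / (M n)%:R); first by have /andP[-> /ltW ->] := x01.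
  rewrite addn0; have := fP n (i%:R / (M n)%:R); rewrite (val_itv iM x01).
  have := idx_itv (M_gt0 n) v01; set j := idx _ v => /andP[].
  rewrite ler_pdivrMr // ler_pdivlMr // => v1 v2.
  suff : `|(p n i)%:R / (M n)%:R - v| <= eps n.
    rewrite !ler_norml => /andP[a1 a2] /andP[a3 a4].
    by apply/andP; split; lra.
  rewrite -[v](@mulfK _ (M n)%:R) ?gt_eqF // -mulrBl normrM.
  rewrite [`|_^-1|]gtr0_norm ?invr_gt0 // ler_pM2r ?invr_gt0 //.
  move: h1 h2 v2; rewrite -/j -!(ler_nat R) -natr1 !natrD => b1 b2 v2.
  by rewrite ler_norml; apply/andP; split; lra.
have vM : (idx (M n.+1) v < M n.+1)%N by rewrite idx_lt // M_gt0.
have := step_cover (sS n) iM vM; rewrite idxS => /(_ h1 h2)[z [zM zi z1 z2]].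
have [x /andP[x1 x2] xv] := IH _ _ zM z1 z2.
exists x; last by rewrite addnS.
by move: x1 x2; rewrite MS => x1 x2; rewrite -zi; apply: subcell; rewrite ?x1 ?M_gt0.
Qed.

(** Compactness: the minimum of [|f x - v|] on the closed cell is below [3 * eps m] for all
    [m >= n], hence zero. *)
Lemma preimage_in_cell v n i : 0 <= v <= 1 -> (i < M n)%N ->
  (p n i <= idx (M n) v + r n)%N -> (idx (M n) v <= p n i + r n)%N ->
  exists2 x, i%:R / (M n)%:R <= x <= i.+1%:R / (M n)%:R & f x = v.
Proof.
move=> v01 iM h1 h2.
have ab : (i%:R : R) / (M n)%:R <= i.+1%:R / (M n)%:R.
  by rewrite ler_pM2r ?invr_gt0 // ler_nat.
have cf : {within `[(i%:R : R) / (M n)%:R, i.+1%:R / (M n)%:R],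
    continuous (fun x => `|f x - v|)}.
  apply: continuous_subspaceT => x; apply: cvg_norm.
  by apply: cvgB; [exact: limit_continuous|exact: cvg_cst].
have [c] := EVT_min ab cf; rewrite in_itv /= => c01 cmin.
exists c => //; apply: (@eps_squeeze 3) => //; exists n => m nm.
have [x xi xv] := approx_preimage (m - n) v01 iM h1 h2.
rewrite subnKC // in xv; apply: le_trans xv; apply: cmin.
by rewrite in_itv.
Qed.
End Limit.

(** * Growth of images and the locally eventually onto property *)

Definition fat_image N (p : nat -> nat) (A : {set 'I_N}) : {set 'I_N} :=
  [set j : 'I_N | [exists a in A, near1 (p a) j]]%SET.

(** [B] contains the image of [A], which has as many elements as [A]. Without growth the two
    coincide, so [B] is closed under passing to neighbours and is everything. *)
Lemma fat_image_grows N p (A : {set 'I_N}) : permn N p -> (0 < #|A|)%N ->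
  (minn N #|A|.+1 <= #|fat_image p A|)%N.
Proof.
move=> /permn_perm[s sE] A0; set B := fat_image p A.
have [//|BA] := leqP; exfalso.
have sB : (s @: A \subset B)%SET.
  apply/fintype.subsetP => _ /imsetP[a aA ->]; rewrite !inE.
  by apply/exists_inP; exists a; rewrite // sE /near1 leqnSn.
have sAB : (s @: A)%SET = B.
  by apply/eqP; rewrite eqEcard sB card_imset; [lia|exact: perm_inj].
have Bnear (i j : 'I_N) : i \in B -> near1 i j -> j \in B.
  rewrite -{1}sAB => /imsetP[a aA ->]; rewrite sE => aj.
  by rewrite !inE; apply/exists_inP; exists a.
have [j0 j0B] : exists j, j \in B.
  by have /card_gt0P[a aA] := A0; exists (s a); rewrite -sAB imset_f.
suff BT : B = [set: 'I_N]%SET by move: BA; rewrite BT cardsT card_ord; lia.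
have up k (i : 'I_N) : (i + k < N)%N -> i \in B ->
      exists2 j : 'I_N, j \in B & j = (i + k)%N :> nat.
  elim: k => [|k IH] ik iB; first by exists i; rewrite ?addn0.
  have [|j jB jE] := IH _ iB; first by lia.
  exists (Ordinal ik) => //; apply: Bnear jB _.
  by rewrite /near1 /= jE; lia.
have down k (i : 'I_N) : i \in B -> exists2 j : 'I_N, j \in B & j = (i - k)%N :> nat.
  elim: k => [|k IH] iB; first by exists i; rewrite ?subn0.
  have [j jB jE] := IH iB.
  have jN : (i - k.+1 < N)%N by have := ltn_ord i; lia.
  exists (Ordinal jN) => //; apply: Bnear jB _.
  by rewrite /near1 /= jE; lia.
apply/setP => j; rewrite finset.in_setT.
have [h|h] := leqP j0 j.
  have [|j' j'B e] := up (j - j0)%N _ _ j0B; first by have := ltn_ord j; lia.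
  by have <- : j' = j by apply: val_inj; rewrite /= e; lia.
have [j' j'B e] := down (j0 - j)%N _ j0B.
by have <- : j' = j by apply: val_inj; rewrite /= e; lia.
Qed.

Section Leo.
Variables (R : realType) (S : nat -> state).
Hypotheses (gS : forall n, good (S n)) (sS : forall n, step n (S n) (S n.+1)).
Variable f : R -> R.
Hypothesis fP : forall n x, `|f x - step_fun (S n) x| <= 2 * mesh R (S n).
Local Notation M n := (sM (S n)).
Local Notation p n := (sp (S n)).

Definition closed_cell N i : set R := `[i%:R / N%:R, i.+1%:R / N%:R].

Lemma idx_closed_cell N i x : (0 < N)%N -> 0 <= x <= 1 -> closed_cell N i x ->
  near1 i (idx N x).
Proof.
move=> N0 x01; rewrite /closed_cell /= in_itv /= => /andP[x1 x2].
have /andP[x3 x4] := idx_itv N0 x01.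
have N0' : 0 < N%:R^-1 :> R by rewrite invr_gt0 ltr0n.
have := le_trans x1 x4; have := le_trans x3 x2.
by rewrite !ler_pM2r // !ler_nat /near1 => -> ->.
Qed.

Lemma closed_cell_sub N i : (i < N)%N -> closed_cell N i `<=` @I01 R.
Proof.
move=> iN x; rewrite /closed_cell /I01 /= !in_itv /= => /andP[x1 x2].
have N0 : 0 < N%:R :> R by rewrite ltr0n; lia.
rewrite (le_trans _ x1) ?divr_ge0 //= (le_trans x2) //.
by rewrite ler_pdivrMr // mul1r ler_nat.
Qed.

(** The cell of [v] is at most one away from [j] (a closed cell contains its right end) and [j] at
    most one away from [p a]; since [1 < sr], the total is within the swept radius. *)
Lemma fat_image_covered n (A : {set 'I_(M n)}) (K : set R) :
  (forall j, j \in A -> closed_cell (M n) j `<=` K) ->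
  forall j, j \in fat_image (p n) A -> closed_cell (M n) j `<=` f @` K.
Proof.
move=> AK j; rewrite inE => /exists_inP[a aA aj] v jv.
have [M0 _ _ _ r1] := gS n.
have v01 : 0 <= v <= 1.
  by have := closed_cell_sub (ltn_ord j) jv; rewrite /I01 /= in_itv.
have jn := idx_closed_cell M0 v01 jv; move: aj jn; rewrite /near1 => aj jn.
have [||x xa xv] := preimage_in_cell gS sS fP v01 (ltn_ord a).
- by lia.
- by lia.
by exists x => //; apply: (AK _ aA); rewrite /closed_cell /= in_itv.
Qed.

Lemma limit_leo : leo f.
Proof.
move=> a b a0 ab b1.
(* With cells shorter than a quarter of [b - a], the one containing the midpoint lies inside the
   interval. *)
have d0 : 0 < (b - a) / 4 by lra.
have [n /(_ n (leqnn n)) en] := eps_small gS sS d0.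
have Mn := le_lt_trans (inv_M_le R gS n) en.
have M0 := M_gt0 gS n; have MR : 0 < (M n)%:R :> R by rewrite ltr0n.
pose c := (a + b) / 2; have c01 : 0 <= c <= 1 by rewrite /c; apply/andP; split; lra.
pose i := Ordinal (idx_lt c M0).
exists (M n); apply/seteqP; split.
  move=> _ [x /= + <-]; rewrite in_itv /= => /andP[xa xb].
  case: (M n) => [|k] /=; rewrite /I01 /= in_itv /=; first by apply/andP; split; lra.
  exact: (limit_itv gS sS fP).
have cellJ : closed_cell (M n) i `<=` `]a, b[.
  move=> x; rewrite /closed_cell /= !in_itv /= => /andP[x1 x2].
  have /andP[c1 c2] := idx_itv M0 c01.
  have iS : (idx (M n) c).+1%:R / (M n)%:R = (idx (M n) c)%:R / (M n)%:R + (M n)%:R^-1 :> R.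
    by rewrite -natr1 mulrDl mul1r.
  by move: c2 x2; rewrite iS /c in c1 * => c2 x2; rewrite /c in c2; apply/andP; split; lra.
(* Starting from one cell, each iterate gains at least one cell until all are filled, so [M n]
   iterates suffice. *)
pose A k := iter k (fat_image (p n)) [set i]%SET.
have Acard k : (minn (M n) k.+1 <= #|A k|)%N.
  elim: k => [|k IH]; first by rewrite /A /= cards1 geq_minr.
  have [_ pP _ _ _] := gS n.
  have Ak0 : (0 < #|A k|)%N by lia.
  by rewrite (leq_trans _ (fat_image_grows pP Ak0)) //; lia.
have AT : A (M n) = [set: 'I_(M n)]%SET.
  apply/eqP; rewrite eqEcard finset.subsetT cardsT card_ord.
  by rewrite (leq_trans _ (Acard _)) //; lia.
have Acov k j : j \in A k -> closed_cell (M n) j `<=` iter k f @` `]a, b[.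
  elim: k j => [|k IH] j.
    by rewrite inE => /eqP -> x /cellJ jx; exists x.
  move=> /(fat_image_covered IH) jf x /jf[_ [y yJ <-] <-].
  by exists y.
move=> v; rewrite /I01 /= in_itv /= => v01.
apply: (Acov _ (Ordinal (idx_lt v M0))); first by rewrite AT inE.
by rewrite /closed_cell /= in_itv /=; apply: idx_itv.
Qed.
End Leo.

(** * Dynamics outside the bad pieces *)

Section GoodPoints.
Variables (R : realType) (S : nat -> state).
Hypotheses (gS : forall n, good (S n)) (sS : forall n, step n (S n) (S n.+1)).
Variable f : R -> R.
Hypothesis fP : forall n x, `|f x - step_fun (S n) x| <= 2 * mesh R (S n).
Local Notation M n := (sM (S n)).
Local Notation p n := (sp (S n)).
Local Notation w n := (sw (S n.+1)).
Local Notation B n := (sB (S n.+1)).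
Implicit Types x y : R.

Let M_R n : 0 < (M n)%:R :> R. Proof. by rewrite ltr0n M_gt0. Qed.
Let w_gt0 n : (0 < w n)%N. Proof. exact: step_w (sS n). Qed.
Let w_R n : 0 < (w n)%:R :> R. Proof. by rewrite ltr0n. Qed.
Let MS n : M n.+1 = (M n * w n)%N. Proof. exact: step_M (sS n). Qed.
Let pM n i : (i < M n)%N -> (p n i < M n)%N.
Proof. by case: (gS n) => _ [+ _] _ _ _; apply. Qed.
Let idxM n x : (idx (M n) x < M n)%N. Proof. by rewrite idx_lt // M_gt0. Qed.
Let idxS n x : (idx (M n.+1) x %/ w n)%N = idx (M n) x.
Proof. by rewrite MS idx_div // M_gt0. Qed.

Definition exchange n x : R :=
  x + ((p n (idx (M n) x))%:R - (idx (M n) x)%:R) / (M n)%:R.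

Definition good_point n x :=
  0 <= x < 1 /\ forall m, (n <= m)%N -> idx (M m.+1) x \notin B m.

Lemma exchange_cell n x : 0 <= x < 1 ->
  0 <= exchange n x < 1 /\ idx (M n) (exchange n x) = p n (idx (M n) x).
Proof.
move=> x01; have := idx_itvo (M_gt0 gS n) x01.
rewrite /exchange; set i := idx (M n) x; move=> /andP[x1 x2].
have jM : (p n i < M n)%N by rewrite pM // /i.
set j := p n i in jM *; set y := x + _.
have y1 : j%:R / (M n)%:R <= y < j.+1%:R / (M n)%:R.
  by move: x1 x2; rewrite /y mulrBl -!natr1 !mulrDl => x1 x2; apply/andP; split; lra.
split; last exact: idxE.
have /andP[y2 y3] := y1; rewrite (le_trans _ y2) ?divr_ge0 //=.
by rewrite (lt_le_trans y3) // ler_pdivrMr // mul1r ler_nat.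
Qed.

Lemma exchangeS n x : idx (M n.+1) x \notin B n ->
  exchange n.+1 x = exchange n x.
Proof.
move=> /(step_bad (sS n) (idxM n.+1 x))[pE _].
rewrite /exchange pE /refine idxS; congr (_ + _).
have zE := divn_eq (idx (M n.+1) x) (w n); rewrite idxS in zE.
rewrite {2}zE MS !natrD !natrM; field.
by rewrite !gt_eqF.
Qed.

Lemma exchange_good n m x : good_point n x -> (n <= m)%N ->
  exchange m x = exchange n x.
Proof.
move=> [_ xB]; elim: m => [|m IH]; first by rewrite leqn0 => /eqP ->.
rewrite leq_eqVlt => /predU1P[<- //|]; rewrite ltnS => nm.
by rewrite exchangeS ?IH // xB.
Qed.

(** From level [n] on the exchanges agree at [x], and each is within one cell of the corresponding
    step function. *)
Lemma limit_good n x : good_point n x -> f x = exchange n x.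
Proof.
move=> gx; apply: (@eps_squeeze R S gS sS 3) => //; exists n => m nm.
rewrite -(exchange_good gx nm).
have := idx_itvo (M_gt0 gS m) gx.1; have := fP m x; have := inv_M_le R gS m.
rewrite /exchange /step_fun mulrBl -natr1 mulrDl mul1r.
rewrite !ler_norml => h1 /andP[h2 h3] /andP[h4 h5].
by apply/andP; split; lra.
Qed.

(** Saturation at work: off the bad set the next piece is again off the bad set, at every later
    level. *)
Lemma good_point_exchange n x : good_point n x -> good_point n (exchange n x).
Proof.
move=> gx; split; first exact: (exchange_cell n gx.1).1.
move=> m nm; rewrite -(exchange_good gx (leqW nm)).
rewrite (exchange_cell m.+1 gx.1).2.
by have [-> ] := step_bad (sS m) (idxM m.+1 x) (gx.2 _ nm).
Qed.

Lemma good_point_iter n j x : good_point n x ->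
  good_point n (iter j f x) /\ iter j f x = x +
    ((iter j (p n) (idx (M n) x))%:R - (idx (M n) x)%:R) / (M n)%:R.
Proof.
move=> gx; suff [h1 h2 h3] : [/\ good_point n (iter j f x),
    idx (M n) (iter j f x) = iter j (p n) (idx (M n) x) &
  iter j f x = x +
    ((iter j (p n) (idx (M n) x))%:R - (idx (M n) x)%:R) / (M n)%:R] by [].
elim: j => [|j [IH1 IH2 IH3]] /=; first by rewrite subrr mul0r addr0.
rewrite (limit_good IH1); split; first exact: good_point_exchange.
  by rewrite (exchange_cell n IH1.1).2 IH2.
by rewrite /exchange IH2 {1}IH3 -addrA -mulrDl; congr (_ + _ / _); ring.
Qed.

Lemma good_point_periodic n j x : good_point n x ->
  iter j f x = x <-> iter j (p n) (idx (M n) x) = idx (M n) x.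
Proof.
move=> /(good_point_iter j)[_ ->]; split=> [|->]; last by rewrite subrr mul0r addr0.
move=> /eqP; rewrite -subr_eq0 addrAC subrr add0r mulf_eq0 invr_eq0 (gt_eqF (M_R n)) orbF.
by rewrite subr_eq0 eqr_nat => /eqP.
Qed.

Lemma I01_good n x : good_point n x -> @I01 R x.
Proof. by move=> [/andP[x0 x1] _]; rewrite /I01 /= in_itv /= x0 ltW. Qed.

Lemma Per_good n x : good_point n x -> Per f x.
Proof.
move=> gx; have [_ pP _ _ _] := gS n; have [c c0 pc] := permn_order pP.
have ex : exists k, (0 < k)%N && (iter k f x == x).
  by exists c; rewrite c0; apply/eqP/(good_point_periodic c gx)/pc.
have [k /andP[k0 /eqP fk] kmin] := ex_minnP ex.
exists k => //; split; first exact: I01_good gx.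
by split=> // i i0 ik fi; have := kmin i; rewrite i0 fi eqxx => /(_ isT); lia.
Qed.

Lemma Per_k_good n k x : good_point n x ->
  iter k (p n) (idx (M n) x) = idx (M n) x ->
  (forall i, (0 < i)%N -> (i < k)%N -> iter i (p n) (idx (M n) x) <> idx (M n) x) ->
  Per_k f k x.
Proof.
move=> gx kx ix; split; first exact: I01_good gx.
split=> [|i i0 ik]; first exact/(good_point_periodic k gx).
by move=> /(good_point_periodic i gx); apply: ix.
Qed.
End GoodPoints.

(** * Lebesgue measure *)

Section Lebesgue.
Variable R : realType.
Local Notation mu := (@lebesgue_measure R).

(** The pushforward under translation agrees with Lebesgue measure on half-open intervals, which
    determine it. *)
Lemma lebesgue_measure_shift (t : R) (A : set R) : measurable A ->
  mu ((fun x => x + t) @^-1` A) = mu A.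
Proof.
move=> mA; have mf : measurable_fun setT
    (fun x : measurableTypeR R => (x : R) + t : measurableTypeR R).
  apply: continuous_measurable_fun => x.
  by apply: cvgD; [exact: cvg_id|exact: cvg_cst].
pose nu : {measure set (measurableTypeR R) -> \bar R} :=
  measure_function_pushforward__canonical__measure_function_Measure mu mf.
rewrite -[LHS]/(nu A); apply/esym/lebesgue_measure_unique => //.
move=> X /ocitvP[->|[[a b] /= ab ->]]; first by rewrite !measure0.
rewrite /pushforward [X in _ = mu X](_ : _ = `]a - t, b - t]%classic).
  by rewrite !lebesgue_measure_itv /= !lte_fin ltrD2r ab -!EFinB; congr EFin; ring.
by apply/seteqP; split=> x /=; rewrite !in_itv /= ltrBlDr lerBrDr.
Qed.

Definition cell N i : set R := `[i%:R / N%:R, i.+1%:R / N%:R[.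

Lemma measurable_cell N i : measurable (cell N i).
Proof. exact: measurable_itv. Qed.

Lemma lebesgue_measure_cell N i : (0 < N)%N -> mu (cell N i) = (N%:R^-1)%:E.
Proof.
move=> N0; have N0' : 0 < N%:R^-1 :> R by rewrite invr_gt0 ltr0n.
rewrite /cell lebesgue_measure_itv /= lte_fin ltr_pM2r // ltr_nat ltnSn.
by rewrite -EFinB -mulrBl -natr1 addrAC subrr add0r mul1r.
Qed.

Lemma cellE N i x : (i < N)%N -> cell N i x <-> 0 <= x < 1 /\ idx N x = i.
Proof.
move=> iN; have N0 : (0 < N)%N by lia.
have N0' : 0 < N%:R :> R by rewrite ltr0n.
rewrite /cell /= in_itv /=; split=> [xi|[x01 <-]]; last exact: idx_itvo.
split; last exact: idxE.
have /andP[x0 x1] := xi; rewrite (le_trans _ x0) ?divr_ge0 //=.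
by rewrite (lt_le_trans x1) // ler_pdivrMr // mul1r ler_nat.
Qed.

Lemma trivIset_cell N : trivIset setT (fun i : 'I_N => cell N i).
Proof.
apply/trivIsetP => i j _ _ ij; rewrite -subset0 => x [xi xj].
move: xi xj => /cellE => /(_ (ltn_ord i))[_ ei] /cellE => /(_ (ltn_ord j))[_ ej].
by move: ij; rewrite -(inj_eq val_inj) /= -ei -ej eqxx.
Qed.

Lemma lebesgue_measure_cells N (E : set R) : (0 < N)%N -> measurable E ->
  mu (E `&` `[0, 1[) = (\sum_(i < N) mu (E `&` cell N i))%E.
Proof.
move=> N0 mE; rewrite -(@measure_bigsetU_ord _ _ _ mu N xpredT).
- congr mu; apply/seteqP; split=> [x [Ex]|x].
    rewrite /= in_itv /= => x01; rewrite -(bigcup_mkord N (fun i => E `&` cell N i)).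
    exists (idx N x); first exact: idx_lt.
    by rewrite /=; split=> //; apply/cellE; [exact: idx_lt|].
  rewrite -(bigcup_mkord N (fun i => E `&` cell N i)) => -[i /= iN [Ex /cellE]].
  by move=> /(_ iN)[x01 _]; split; rewrite //= in_itv.
- by move=> i; apply: measurableI => //; exact: measurable_cell.
- exact: trivIset_setIl (@trivIset_cell N).
Qed.

Lemma lebesgue_measure_I01_co (E : set R) : measurable E ->
  mu (@I01 R `&` E) = mu (E `&` `[0, 1[).
Proof.
move=> mE; have mco : measurable (E `&` `[0, 1[) by apply: measurableI.
have mI : measurable (@I01 R `&` E) by apply: measurableI => //; exact: measurable_itv.
apply/eqP; rewrite eq_le; apply/andP; split.
  rewrite -[leRHS]adde0 -(lebesgue_measure_set1 (1 : R)).
  apply: (le_trans _ (measureU2 mu mco (measurable_set1 _))).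
  apply: le_measure; rewrite ?inE //; first exact: measurableU.
  move=> x [] + Ex; rewrite /I01 /= in_itv /= => /andP[x0].
  by rewrite le_eqVlt => /predU1P[->|x1]; [right|left; split; rewrite //= in_itv /= x0].
apply: le_measure; rewrite ?inE //.
move=> x [Ex]; rewrite /I01 /= !in_itv /= => /andP[-> /ltW ->]; by split.
Qed.

Lemma lebesgue_measure_I01 : mu (@I01 R) = 1%E.
Proof. by rewrite /I01 lebesgue_measure_itv /= lte_fin ltr01 -EFinB subr0. Qed.

Lemma lebesgue_measure_seq_cells N (s : seq nat) : (0 < N)%N ->
  (mu (\big[setU/set0]_(z <- s) cell N z) <= ((size s)%:R / N%:R)%:E)%E.
Proof.
move=> N0; elim: s => [|z s IH]; first by rewrite big_nil measure0 mul0r.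
have ms : measurable (\big[setU/set0]_(z <- s) cell N z).
  by apply: bigsetU_measurable => i _; exact: measurable_cell.
rewrite big_cons; set U := (X in _ `|` X) in ms IH *.
apply: (@le_trans _ _ (mu (cell N z) + mu U)%E).
  by apply: measureU2 => //; exact: measurable_cell.
by rewrite lebesgue_measure_cell // /= -natr1 addrC mulrDl mul1r EFinD; apply: leeD.
Qed.
End Lebesgue.

(** Turns an inequality for complements into the reverse inequality; total mass 1 excludes infinite
    values. *)
Lemma lee_complement (R : realType) (a b c d : \bar R) :
  (d <= b -> c + d = 1 -> a + b = 1 -> a <= c)%E.
Proof.
case: a => [a| |]; case: b => [b| |]; case: c => [c| |]; case: d => [d| |] //=.
by rewrite -!EFinD !lee_fin => ? [] ? [] ?; lra.
Qed.

(** * Invariance of Lebesgue measure *)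

Section LimitMeasure.
Variables (R : realType) (S : nat -> state).
Hypotheses (gS : forall n, good (S n)) (sS : forall n, step n (S n) (S n.+1)).
Variable f : R -> R.
Hypothesis fP : forall n x, `|f x - step_fun (S n) x| <= 2 * mesh R (S n).
Local Notation mu := (@lebesgue_measure R).
Local Notation M n := (sM (S n)).
Local Notation co01 := `[(0 : R)%R, 1%R[%classic.
Local Notation p n := (sp (S n)).
Local Notation B n := (sB (S n.+1)).
Implicit Types (x y : R) (A : set R).

Let M0 n : (0 < M n)%N. Proof. exact: M_gt0. Qed.
Let M_R n : 0 < (M n)%:R :> R. Proof. by rewrite ltr0n M_gt0. Qed.

Definition bad n : set R :=
  \bigcup_k \big[setU/set0]_(z <- B (n + k)) @cell R (M (n + k).+1) z.

Lemma measurable_bad n : measurable (bad n).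
Proof.
apply: bigcupT_measurable => k.
by apply: bigsetU_measurable => i _; exact: measurable_cell.
Qed.

Lemma leq_M n k : (M n <= M (n + k))%N.
Proof.
elim: k => [|k IH]; first by rewrite addn0.
by rewrite addnS (step_M (sS _)) (leq_trans IH) // leq_pmulr // (step_w (sS _)).
Qed.

Definition bad_bound n : R := (M n)%:R^-1 / (2 ^ n.+1)%:R.

Lemma bad_bound_ge0 n : 0 <= bad_bound n.
Proof. by rewrite divr_ge0 // invr_ge0. Qed.

(** By [step_size], level [n + k] contributes at most [bad_bound n / 2 ^ k.+1]; the geometric series
    sums to [bad_bound n]. *)
Lemma measure_bad n : (mu (bad n) <= (bad_bound n)%:E)%E.
Proof.
apply: (le_trans _ (epsilon_trick0 xpredT (bad_bound_ge0 n))).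
apply: (@le_trans _ _ (\sum_(k <oo)
  mu (\big[setU/set0]_(z <- B (n + k)) @cell R (M (n + k).+1) z))%E).
  apply: measure_sigma_subadditive => //; last exact: measurable_bad.
  by move=> k; apply: bigsetU_measurable => i _; exact: measurable_cell.
apply: lee_nneseries => k _ //.
apply: (le_trans (lebesgue_measure_seq_cells _ _ (M0 _))); rewrite lee_fin.
have P0 j : 0 < (2 ^ j)%:R :> R by rewrite ltr0n expn_gt0.
rewrite /bad_bound -!invfM -!natrM ler_pdivrMr //.
have N0 : (0 < M n * 2 ^ n.+1 * 2 ^ k.+1)%N by rewrite !muln_gt0 M0 !expn_gt0.
rewrite ler_pdivlMl ?ltr0n // -natrM ler_nat.
apply: leq_trans (step_size (sS (n + k))).
rewrite -[(M n * _ * _)%N]mulnA -expnD mulnC -[leqRHS]mulnA leq_mul2l.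
by rewrite leq_mul ?orbT ?leq_M // leq_exp2l //; lia.
Qed.

Lemma good_point_bad n x : 0 <= x < 1 -> ~ bad n x -> good_point S n x.
Proof.
move=> x01 xb; split=> // m nm; apply/negP => xB; apply: xb.
exists (m - n)%N => //; rewrite subnKC // -bigcup_seq.
by exists (idx (M m.+1) x) => //; apply/(cellE _ (idx_lt x (M0 _))).
Qed.

Let f_measurable : measurable_fun setT f.
Proof. by apply: continuous_measurable_fun; exact: (limit_continuous gS sS fP). Qed.

Let preimage_measurable A : measurable A -> measurable (f @^-1` A).
Proof. by move=> mA; rewrite -[X in measurable X]setTI; exact: f_measurable. Qed.

(** Translate the part of [A] in cell [s i] back to cell [i]: a point there is bad, or [f] acts on
    it by that translation and it lies in the preimage. Summing over the permuted cells gives the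
    bound. *)
Lemma measure_preimage_bad n A : measurable A ->
  (mu (A `&` co01) <= mu ((f @^-1` A) `&` co01) + mu (bad n))%E.
Proof.
move=> mA; have mfA := preimage_measurable mA.
have mb := measurable_bad n; have mc := @measurable_cell R (M n).
have [_ pP _ _ _] := gS n; have [s sE] := permn_perm pP.
rewrite (lebesgue_measure_cells (M0 n)) // (reindex_inj (@perm_inj _ s)) /=.
apply: (@le_trans _ _ (mu ((f @^-1` A) `&` co01) + mu (bad n `&` co01))%E); last first.
  by apply: leeD => //; apply: le_measure;
    [by rewrite inE; exact: measurableI|by rewrite inE|exact: subIsetl].
rewrite !(lebesgue_measure_cells (M0 n)) // -big_split /=; apply: lee_sum => i _.
have [mA1 mA2 mA3] : [/\ measurable ((f @^-1` A) `&` @cell R (M n) i),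
   measurable (bad n `&` @cell R (M n) i) & measurable (A `&` @cell R (M n) (s i))].
  by split; apply: measurableI.
apply: (le_trans _ (measureU2 mu mA1 mA2)).
pose t : R := ((p n i)%:R - i%:R) / (M n)%:R.
rewrite -(lebesgue_measure_shift t mA3); apply: le_measure; rewrite ?inE.
- rewrite -[X in measurable X]setTI.
  have : measurable_fun setT (fun x => x + t).
    by apply: continuous_measurable_fun => x; apply: cvgD; [exact: cvg_id|exact: cvg_cst].
  by apply.
- exact: measurableU.
move=> x [Axt xt].
have xi : @cell R (M n) i x.
  move: xt; rewrite /cell /= !in_itv /= sE /t mulrBl -!natr1 !mulrDl => /andP[x1 x2].
  by apply/andP; split; lra.
have [bx|nbx] := pselect (bad n x); [by right|left; split=> //].
have [x01 ix] := (cellE _ (ltn_ord i)).1 xi.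
by rewrite /= (limit_good gS sS fP (good_point_bad x01 nbx)) /exchange ix.
Qed.

Lemma bad_bound_small (d : R) : 0 < d -> exists n, bad_bound n < d.
Proof.
move=> d0; have [n /(_ n (leqnn n)) nd] := eps_small gS sS d0.
exists n; apply: le_lt_trans nd; apply: le_trans (inv_M_le R gS n).
rewrite /bad_bound ler_pdivrMr ?ltr0n ?expn_gt0 // ler_peMr ?invr_ge0 //.
by rewrite ler1n expn_gt0.
Qed.

Lemma measure_le_preimage A : measurable A ->
  (mu (@I01 R `&` A) <= mu (@I01 R `&` f @^-1` A))%E.
Proof.
move=> mA; rewrite !lebesgue_measure_I01_co //; last exact: preimage_measurable.
apply/lee_addgt0Pr => d d0; have [n nd] := bad_bound_small d0.
apply: (le_trans (measure_preimage_bad n mA)); apply: leeD => //.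
by apply: (le_trans (measure_bad n)); rewrite lee_fin ltW.
Qed.

Let mI : measurable (@I01 R). Proof. exact: measurable_itv. Qed.
Let fI x : @I01 R (f x).
Proof. by rewrite /I01 /= in_itv; exact: limit_itv fP x. Qed.

(** The inequality [measure_le_preimage] for the complement of [A] gives the reverse one for [A]. *)
Lemma limit_preserves A : measurable A ->
  mu (@I01 R `&` f @^-1` A) = mu (@I01 R `&` A).
Proof.
move=> mA; apply/eqP; rewrite eq_le measure_le_preimage // andbT.
have total E : measurable E -> (mu (@I01 R `&` E) + mu (@I01 R `&` ~` E) = 1)%E.
  move=> mE; rewrite -measureU; last 3 first.
  - by apply: measurableI.
  - by apply: measurableI => //; exact: measurableC.
  - by rewrite setIACA setICr setI0.
  by rewrite -setIUr setUv setIT; exact: lebesgue_measure_I01.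
have h := measure_le_preimage (measurableC mA).
exact: lee_complement h (total _ mA) (total _ (preimage_measurable mA)).
Qed.

Lemma in_C_lambda_limit : in_C_lambda f.
Proof.
split.
- by move=> x _; exact: fI.
- exact/continuous_subspaceT/(limit_continuous gS sS fP).
- move=> A mA AI; rewrite /leb limit_preserves //.
  by congr mu; apply/setIidPr.
Qed.
End LimitMeasure.

(** * Measure of the sets of periodic points *)

Lemma measurable_iter (R : realType) (f : R -> R) j :
  measurable_fun setT f -> measurable_fun setT (iter j f).
Proof.
move=> mf; elim: j => [|j IH]; first exact: measurable_id.
exact: measurableT_comp mf IH.
Qed.

Lemma measurable_Per_k (R : realType) (f : R -> R) k :
  measurable_fun setT f -> measurable (Per_k f k).
Proof.
move=> mf; pose F j := [set x : R | iter j f x = x].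
have mF j : measurable (F j).
  have -> : F j = (fun x => iter j f x - x) @^-1` [set 0].
    apply/seteqP; split=> x; rewrite /F /=; first by move=> ->; rewrite subrr.
    by move=> /eqP; rewrite subr_eq0 => /eqP.
  rewrite -[X in measurable X]setTI.
  have : measurable_fun setT (fun x => iter j f x - x).
    by apply: measurable_funB; [exact: measurable_iter|exact: measurable_id].
  by apply => //; exact: measurable_set1.
have -> : Per_k f k = @I01 R `&` (F k `\` \bigcup_(i in [set i | (0 < i < k)%N]) F i).
  apply/seteqP; split=> [x [Ix [kx ix]]|x [Ix [kx ix]]].
    split=> //; split=> // -[i /= /andP[i0 ik]]; exact: ix.
  split=> //; split=> // i i0 ik fi; apply: ix; exists i => //=.
  by rewrite i0.
apply: measurableI; first exact: measurable_itv.
by apply: measurableD => //; apply: bigcup_measurable.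
Qed.

Lemma measurable_Per (R : realType) (f : R -> R) :
  measurable_fun setT f -> measurable (Per f).
Proof. by move=> mf; apply: bigcup_measurable => k _; exact: measurable_Per_k. Qed.

Section PeriodicMeasure.
Variables (R : realType) (S : nat -> state).
Hypotheses (gS : forall n, good (S n)) (sS : forall n, step n (S n) (S n.+1)).
Variable f : R -> R.
Hypothesis fP : forall n x, `|f x - step_fun (S n) x| <= 2 * mesh R (S n).
Local Notation mu := (@lebesgue_measure R).

Let mf : measurable_fun setT f.
Proof. by apply: continuous_measurable_fun; exact: (limit_continuous gS sS fP). Qed.

Lemma measure_Per : mu (Per f) = 1%E.
Proof.
have mP := measurable_Per mf; have mI : measurable (@I01 R) by exact: measurable_itv.
apply/eqP; rewrite eq_le; apply/andP; split.
  rewrite -(lebesgue_measure_I01 R); apply: le_measure; rewrite ?inE //.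
  by move=> x [k _ []].
apply/lee_addgt0Pr => d d0; have [n nd] := bad_bound_small gS sS d0.
have mb := @measurable_bad R S n.
rewrite -(lebesgue_measure_I01 R) -[@I01 R]setIT lebesgue_measure_I01_co //.
have cov : (mu (setT `&` `[(0 : R)%R, 1%R[%classic) <= mu (Per f) + mu (@bad R S n))%E.
  apply: (le_trans _ (measureU2 mu mP mb)); apply: le_measure; rewrite ?inE //.
  - exact: measurableI.
  - exact: measurableU.
  move=> x [_]; rewrite /= in_itv /= => x01.
  have [bx|nbx] := pselect (@bad R S n x); [by right|left].
  exact: (Per_good gS sS fP (good_point_bad gS x01 nbx)).
apply: (le_trans cov); apply: leeD => //.
by apply: (le_trans (measure_bad R gS sS n)); rewrite lee_fin ltW.
Qed.

(** The cell [u] of the cycle has measure [1 / sM (S n.+1)], strictly more than all bad pieces of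
    later levels together, and its remaining points have exact period [n.+1]. *)
Lemma measure_Per_k n : (0 < mu (Per_k f n.+1))%E.
Proof.
have [u uM [uk ui]] := step_per (sS n).
have mP := measurable_Per_k n.+1 mf; have mb := @measurable_bad R S n.+1.
have M0 : (0 < sM (S n.+1))%N by exact: M_gt0.
have cP : (mu (cell (sM (S n.+1)) u) <= mu (Per_k f n.+1) + mu (@bad R S n.+1))%E.
  apply: (le_trans _ (measureU2 mu mP mb)); apply: le_measure; rewrite ?inE //.
  - exact: measurable_cell.
  - exact: measurableU.
  move=> x /(cellE _ uM)[x01 xu].
  have [bx|nbx] := pselect (@bad R S n.+1 x); [by right|left].
  by apply: (Per_k_good gS sS fP (good_point_bad gS x01 nbx)); rewrite xu.
rewrite ltNge; apply/negP => P0; move: cP; rewrite lebesgue_measure_cell //.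
apply/negP; rewrite -ltNge.
apply: (@le_lt_trans _ _ (bad_bound R S n.+1)%:E).
  by rewrite -[leRHS]add0e; apply: leeD => //; exact: measure_bad.
rewrite lte_fin /bad_bound ltr_pdivrMr ?ltr0n ?expn_gt0 // ltr_pMr ?invr_gt0 ?ltr0n //.
by rewrite ltr1n -[1%N](expn0 2) ltn_exp2l.
Qed.
End PeriodicMeasure.

(** * The initial permutation *)

Lemma within_continuous_ball (R : realType) (A : set R) (g : R -> R) x e :
  {within A, continuous g} -> A x -> 0 < e ->
  exists2 r : R, 0 < r & forall y, A y -> `|x - y| < r -> `|g x - g y| < e.
Proof.
move=> /subspace_continuousP cg Ax e0; have /cvgrPdist_lt/(_ e e0) := cg _ Ax.
rewrite near_withinE => /nbhs_ballP[r /= r0 H].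
by exists r => // y Ay xy; apply: H.
Qed.

Lemma uniform_continuity_I01 (R : realType) (g : R -> R) e :
  {within @I01 R, continuous g} -> 0 < e ->
  \forall N \near \oo, forall x y : R, I01 x -> I01 y ->
    `|x - y| <= N.+1%:R^-1 -> `|g x - g y| <= e.
Proof.
move=> cg e0.
have /compact_near_coveringP cI := @segment_compact R 0 1.
pose P N x := forall y, I01 x -> I01 y -> `|x - y| <= N.+1%:R^-1 -> `|g x - g y| <= e.
suff : \forall N \near \oo, @I01 R `<=` P N.
  by apply: filterS => N H x y Ix; exact: H.
apply: cI => x Ix.
have e2 : 0 < e / 2 by rewrite divr_gt0.
have [r r0 H] := within_continuous_ball cg Ix e2.
have r2 : 0 < r / 2 by rewrite divr_gt0.
near=> x' N => y Ix' Iy x'y.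
have xx' : `|x - x'| < r / 2.
  by near: x'; apply/nbhs_ballP; exists (r / 2).
have Nr : N.+1%:R^-1 < r / 2 by near: N; exact: near_infty_natSinv_lt (PosNum r2).
have xy : `|x - y| < r.
  rewrite (le_lt_trans (ler_distD x' x y)) // [ltRHS]splitr ltrD //.
  exact: le_lt_trans x'y Nr.
have := H _ Iy xy; have /(H _ Ix') : `|x - x'| < r by lra.
by rewrite (distrC (g x) (g x')) => h1 h2; have := ler_distD (g x) (g x') (g y); lra.
Unshelve. all: by end_near. Qed.

Section Rank.
Variables (R : realType) (N : nat) (y : nat -> R).

(* Ties are broken by the index, so that [rank] is injective. *)
Definition below k i := (y k < y i) || (y k == y i) && (k < i)%N.
Definition rank i := #|[set k : 'I_N | below k i]%SET|.

Lemma below_trans i j k : below i j -> below j k -> below i k.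
Proof.
rewrite /below => /orP[h1|/andP[/eqP -> h1]] /orP[h2|/andP[/eqP <- h2]].
- by rewrite (lt_trans h1).
- by rewrite h1.
- by rewrite h2.
- by rewrite eqxx (ltn_trans h1) ?orbT.
Qed.

Lemma belowxx i : below i i = false.
Proof. by rewrite /below ltxx ltnn andbF. Qed.

Lemma below_total i j : i != j -> below i j || below j i.
Proof. by rewrite /below; case: (ltgtP (y i) (y j)) => //=; lia. Qed.

Lemma rank_lt i j : (i < N)%N -> below i j -> (rank i < rank j)%N.
Proof.
move=> iN ij; apply: proper_card; apply/properP; split.
  by apply/fintype.subsetP => k; rewrite !inE => /below_trans; exact.
by exists (Ordinal iN); rewrite !inE //= belowxx.
Qed.

Lemma permn_rank : permn N rank.
Proof.
split=> [i iN|i j iN jN e].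
  rewrite /rank -[ltnRHS]card_ord -cardsT; apply: proper_card.
  apply/properP; split; first exact: finset.subsetT.
  by exists (Ordinal iN); rewrite !inE //= belowxx.
apply/eqP/negPn/negP => /below_total /orP[/(rank_lt iN)|/(rank_lt jN)].
  by rewrite e ltnn.
by rewrite e ltnn.
Qed.
End Rank.

Section CellCount.
Variables (R : realType) (g : R -> R) (N : nat).
Hypotheses (gC : in_C_lambda g) (N0 : (0 < N)%N).
Local Notation mu := (@lebesgue_measure R).

(** The selected cells lie in the preimage of [[a, b]], whose measure is at most [b - a] because [g]
    preserves the measure. *)
Lemma card_cells_le (P : pred 'I_N) (a b : R) : a <= b ->
  (forall k x, P k -> cell N k x -> a <= g x <= b) ->
  #|P|%:R / N%:R <= b - a.
Proof.
case: gC => gI cg gmu ab Pg.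
have mI : measurable (@I01 R) by exact: measurable_itv.
pose A : set R := @I01 R `&` `[a, b].
have mA : measurable A by apply: measurableI => //; exact: measurable_itv.
pose U : set R := \big[setU/set0]_(k < N | P k) cell N k.
have mU : measurable U by apply: bigsetU_measurable => k _; exact: measurable_cell.
have muU : mu U = (#|P|%:R / N%:R)%:E.
  rewrite /U measure_bigsetU_ord_cond; last 2 first.
  - by move=> k _; exact: measurable_cell.
  - by move=> i j _ _; exact: (@trivIset_cell R N i j I I).
  rewrite (eq_bigr (fun=> (N%:R^-1 : R)%:E)); last first.
    by move=> k _; exact: lebesgue_measure_cell.
  by rewrite sumEFin sumr_const; congr EFin; exact: esym (mulr_natl _ _).
rewrite -lee_fin -muU.
have mgA : measurable (@I01 R `&` g @^-1` A).
  by have := subspace_continuous_measurable_fun mI cg; apply.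
apply: (@le_trans _ _ (mu (@I01 R `&` g @^-1` A))).
  apply: le_measure; rewrite ?inE // => x.
  rewrite /U -bigcup_seq_cond => -[k /= /andP[_ Pk] xk].
  have xI : I01 x.
    have [/andP[x0 x1] _] := (cellE _ (ltn_ord k)).1 xk.
    by rewrite /I01 /= in_itv /= x0 ltW.
  by split=> //; split; [exact: gI|rewrite /= in_itv; exact: Pg xk].
have := gmu A mA (@subIsetl _ _ _); rewrite /leb => ->.
apply: (@le_trans _ _ (mu `[a, b])).
  apply: le_measure; rewrite ?inE; [exact: mA|exact: measurable_itv|exact: subIsetr].
rewrite lebesgue_measure_itv /= lte_fin; case: ltP => // _.
by rewrite lee_fin subr_ge0.
Qed.
End CellCount.

Lemma init_state (R : realType) (g : R -> R) (d : R) : in_C_lambda g -> 0 < d ->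
  exists S0, [/\ good S0, mesh R S0 <= d &
    forall x, I01 x -> `|step_fun S0 x - g x| <= d].
Proof.
move=> gC d0; have [gI cg _] := gC.
pose h := d / 20; have h0 : 0 < h by rewrite divr_gt0.
have [n [unif Nh]] : exists n, (forall x y : R, I01 x -> I01 y ->
    `|x - y| <= n.+1%:R^-1 -> `|g x - g y| <= h) /\ n.+1%:R^-1 < h.
  near \oo => n; exists n; split; near: n; first exact: uniform_continuity_I01.
  exact: near_infty_natSinv_lt (PosNum h0).
pose N := n.+1; have N0 : (0 < N)%N by [].
have NR : 0 < N%:R :> R by rewrite ltr0n.
pose z k : R := k%:R / N%:R; pose y k := g (z k).
have zI k : (k < N)%N -> I01 (z k).
  move=> kN; rewrite /I01 /= in_itv /= divr_ge0 //= ler_pdivrMr // mul1r ler_nat.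
  exact: ltnW.
have y01 k : (k < N)%N -> 0 <= y k <= 1.
  by move=> /zI/gI; rewrite /I01 /= in_itv.
have gcell k x : (k < N)%N -> k%:R / N%:R <= x <= k.+1%:R / N%:R -> I01 x ->
    `|y k - g x| <= h.
  move=> kN /andP[x1 x2] Ix; apply: unif => //; first exact: zI.
  move: x2; rewrite -natr1 mulrDl mul1r => x2.
  by rewrite /z ler_norml; apply/andP; split; rewrite -/N; lra.
have cellI k (x : R) : (k < N)%N -> cell N k x ->
    I01 x /\ k%:R / N%:R <= x <= k.+1%:R / N%:R.
  move=> kN xk; have [/andP[x0 x1] _] := (cellE _ kN).1 xk.
  split; first by rewrite /I01 /= in_itv /= x0 ltW.
  by move: xk; rewrite /cell /= in_itv /= => /andP[-> /ltW ->].
pose p0 := rank N y; have p0P : permn N p0 := permn_rank N y.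
have p0N i : (i < N)%N -> (p0 i < N)%N by case: p0P => + _; apply.
(* Cells ranked below [i] have values of [g] in [[0, y i + h]], the others in [[y i - h, 1]];
   counting both families bounds the rank from the two sides. *)
have near0 i : (i < N)%N -> `|(p0 i)%:R / N%:R - y i| <= h.
  move=> iN; have /andP[yi0 yi1] := y01 _ iN.
  have up : (p0 i)%:R / N%:R <= (y i + h) - 0.
    rewrite /p0 /rank cardsE; apply: (card_cells_le gC) => // [|k x]; first by lra.
    move=> ki /(cellI _ _ (ltn_ord k))[Ix xk].
    have := gcell _ _ (ltn_ord k) xk Ix; have := gI _ Ix.
    rewrite /I01 /= in_itv /= ler_norml => /andP[-> _] /andP[h1 h2] /=.
    have : y k <= y i by move: ki; rewrite /below => /orP[/ltW|/andP[/eqP ->]].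
    by lra.
  have dn : (N - p0 i)%:R / N%:R <= 1 - (y i - h).
    have -> : (N - p0 i)%N = #|[pred k : 'I_N | ~~ below y k i]|.
      have := cardC [pred k : 'I_N | below y k i]; rewrite card_ord /p0 /rank cardsE.
      have sub (a b c : nat) : (a + b = c -> c - a = b)%N by lia.
      by move=> /sub ->; apply: eq_card => k; rewrite !inE.
    apply: (card_cells_le gC) => // [|k x]; first by lra.
    move=> ki /(cellI _ _ (ltn_ord k))[Ix xk].
    have := gcell _ _ (ltn_ord k) xk Ix; have := gI _ Ix.
    rewrite /I01 /= in_itv /= ler_norml => /andP[_ ->] /andP[h1 h2]; rewrite andbT.
    have : y i <= y k.
      by have : ~~ below y k i := ki; rewrite /below negb_or => /andP[]; rewrite -leNgt.
    by lra.
  move: dn; rewrite natrB ?(ltnW (p0N _ iN)) // mulrBl divff ?gt_eqF // => dn.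
  by rewrite ler_norml; apply/andP; split; lra.
(* Ranks of adjacent cells differ by at most [3 * h * N]: one [h] for each rank and one for the
   variation of [g]. *)
pose J := Num.truncn (3 * h * N%:R).
have J3 : J%:R <= 3 * h * N%:R.
  by have /truncn_itv/andP[] : 0 <= 3 * h * N%:R by rewrite !mulr_ge0 // ltW.
have natJ (a b : nat) : a%:R / N%:R - b%:R / N%:R <= 3 * h -> (a <= b + J)%N.
  rewrite -mulrBl ler_pdivrMr // => ab; rewrite -leq_subLR.
  have [ba|ab'] := leqP b a; last by rewrite (eqP (ltnW ab' : (a - b == 0)%N)).
  rewrite /J truncn_ge_nat ?natrB //; first by rewrite !mulr_ge0 // ltW.
have jump0 i : (i.+1 < N)%N -> (p0 i <= p0 i.+1 + J)%N /\ (p0 i.+1 <= p0 i + J)%N.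
  move=> iN; have iN' := ltnW iN.
  have yy : `|y i - y i.+1| <= h.
    apply: unif; [exact: zI|exact: zI|].
    rewrite /z -mulrBl -natr1 opprD addrA subrr sub0r normrM normrN1 mul1r.
    by rewrite gtr0_norm ?invr_gt0.
  have := near0 _ iN; have := near0 _ iN'; move: yy.
  rewrite !ler_norml => /andP[a1 a2] /andP[a3 a4] /andP[a5 a6].
  by split; apply: natJ; lra.
(* Discrete intermediate value: at the least [e] with [p0 e <= e], the previous index is moved up,
   so [p0 e] is within one jump of [e]. *)
have [e eN [e1 e2]] : exists2 e, (e < N)%N & (p0 e <= e)%N /\ (e <= p0 e + J)%N.
  have ex : exists e, (p0 e <= e)%N by exists n; rewrite -ltnS p0N.
  have [e pe emin] := ex_minnP ex; exists e.
    by rewrite ltnS; apply: emin; rewrite -ltnS p0N.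
  split=> //; case: e pe emin => // e pe emin.
  have pe' : (e < p0 e)%N by rewrite ltnNge; apply/negP => /emin; rewrite ltnn.
  have eN : (e.+1 < N)%N.
    by rewrite ltnS; apply: emin; rewrite -ltnS p0N.
  by have [h1 h2] := jump0 _ eN; lia.
(* A transposition of values at most [J] apart makes [e] fixed; adjacent jumps grow to at most
   [3 * J], and the added 2 in [sr] ensures [1 < sr]. *)
pose p := transp e (p0 e) \o p0.
have pp0 i : (p i <= p0 i + J)%N /\ (p0 i <= p i + J)%N.
  by rewrite /p /= /transp; repeat case: ifP; lia.
pose S0 := State N p (3 * J + 2) e 0 [::].
have pfix : p e = e by rewrite /p /= /transp eqxx; case: eqP.
have gS0 : good S0.
  split=> //=; last by lia.
    by apply: permn_comp => //; apply: permn_transp => //; exact: p0N.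
  by move=> i /jump0; have := pp0 i; have := pp0 i.+1; lia.
have dh : d = 20 * h by rewrite /h; field.
exists S0; split=> //.
  rewrite /mesh /= ler_pdivrMr // -addnA natrD natrM.
  have : 1 <= h * N%:R by rewrite -ler_pdivrMr // div1r ltW.
  by rewrite dh; move: J3; lra.
move=> x Ix; have x01 : 0 <= x <= 1 by move: Ix; rewrite /I01 /= in_itv.
have iN : (idx N x < N)%N by apply: idx_lt.
rewrite /step_fun /=; set i := idx N x in iN *.
have gi := gcell _ _ iN (idx_itv N0 x01) Ix; have := near0 _ iN.
have pi : `|(p i)%:R / N%:R - (p0 i)%:R / N%:R| <= 3 * h.
  rewrite -mulrBl normrM [`|_^-1|]gtr0_norm ?invr_gt0 // ler_pdivrMr //.
  apply: le_trans J3; have [] := pp0 i; rewrite -!(ler_nat R) !natrD => h1 h2.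
  by rewrite ler_norml; apply/andP; split; lra.
move: gi pi; rewrite !ler_norml dh => /andP[a1 a2] /andP[a3 a4] /andP[a5 a6].
by apply/andP; split; lra.
Unshelve. all: by end_near. Qed.

Theorem theorem1p2 (R : realType) (g : R -> R) (eps : R) :
  in_C_lambda g -> 0 < eps ->
  exists f : R -> R,
    [/\ in_C_lambda f, leo f,
        leb (Per f) = 1%E,
        (forall k : nat, (1 <= k)%N -> (0 < leb (Per_k f k))%E) &
        exists2 d : R, d < eps & forall x, I01 x -> `|f x - g x| <= d].
Proof.
move=> gC e0; have e4 : 0 < eps / 4 by rewrite divr_gt0.
have [S0 [gS0 m0 near0]] := init_state gC e4.
have [S [S0E gS sS]] := chain_exists gS0.
have [f fP] := limit_exists R gS sS.
exists f; split.
- exact: (in_C_lambda_limit gS sS fP).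
- exact: (limit_leo gS sS fP).
- exact: (measure_Per gS sS fP).
- by case=> // k _; exact: (measure_Per_k gS sS fP k).
(* The limit is within two meshes of the initial step function, itself within [eps / 4] of [g]. *)
exists (3 * (eps / 4)); first by lra.
move=> x Ix; have := near0 x Ix; have := fP 0%N x; rewrite S0E.
rewrite !ler_norml => /andP[h1 h2] /andP[h3 h4].
by apply/andP; split; lra.
Qed.
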